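(* The following is provable in $\mathsf{RCA}_0$: every partial order which contains neither $\mathbf{2}\oplus\mathbf{2}$ nor $\mathbf{3}\oplus\mathbf{1}$ is a proper interval order.
   Context: $\mathsf{RCA}_0$ is the base subsystem of second-order arithmetic ($\Delta^0_1$ comprehension, $\Sigma^0_1$ induction). A partial order $\mathbf{P}=(P,\leq_P)$ is a set $P\subseteq\mathbb{N}$ with a reflexive, transitive, antisymmetric relation; a linear order has any two elements comparable; $p<_P q$ means $p\leq_P q$, $p\ne q$. $\mathbf{P}$ is a proper interval order if there are a linear order $\mathbf{L}=(L,\leq_L)$ and $F\subseteq P\times L$ such that, with $F(p)=\{x:(p,x)\in F\}$: (i1) each $F(p)$ is nonempty and convex ($x,y\in F(p)$, $x<_L z<_L y$ imply $z\in F(p)$); (i2) $p<_P q$ iff $x<_L y$ for all $x\in F(p),y\in F(q)$; (i4) $F(p)\subseteq F(q)$ implies $F(p)=F(q)$ for all $p,q$. $\mathbf{P}$ does not contain $\mathbf{2}\oplus\mathbf{2}$ if $p_0<_P q_0$, $p_1<_P q_1$ imply $p_0\leq_P q_1$ or $p_1\leq_P q_0$; it does not contain $\mathbf{3}\oplus\mathbf{1}$ if for all $p_0,p_1,p_2,q\in P$, $p_0<_P p_1<_P p_2$ implies $p_0\leq_P q$ or $q\leq_P p_2$. *)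

(* Defs.v *)
From Stdlib Require Import List.
Import ListNotations.

(** * Second-order arithmetic

    Two-sorted first-order logic in the language 0, 1, +, *, =, <, ∈.  Number
    variables and set variables are de Bruijn indices in two separate name
    spaces: a number quantifier leaves set indices unchanged and conversely. *)

Inductive term : Type :=
| tvar (n : nat)
| tzero
| tone
| tadd (t u : term)
| tmul (t u : term).

Inductive form : Type :=
| fbot
| feq (t u : term)
| flt (t u : term)
| fmem (t : term) (X : nat)
| fimp (phi psi : form)
| fall (phi : form)    (* over numbers *)
| fAll (phi : form).   (* over sets *)

(** The logic is classical, so the other connectives are abbreviations. *)

Definition fnot (phi : form) : form := fimp phi fbot.
Definition fand (phi psi : form) : form := fnot (fimp phi (fnot psi)).
Definition for_ (phi psi : form) : form := fimp (fnot phi) psi.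
Definition fiff (phi psi : form) : form := fand (fimp phi psi) (fimp psi phi).
Definition fex (phi : form) : form := fnot (fall (fnot phi)).
Definition fEx (phi : form) : form := fnot (fAll (fnot phi)).

Declare Scope form_scope.
Delimit Scope form_scope with form.
Bind Scope form_scope with form.
Bind Scope form_scope with term.
Notation "0" := tzero : form_scope.
Notation "1" := tone : form_scope.
Infix "+" := tadd : form_scope.
Infix "*" := tmul : form_scope.
Infix "≐" := feq (at level 70, no associativity) : form_scope.
Infix "<" := flt : form_scope.
Infix "∈" := fmem (at level 70, no associativity) : form_scope.
Notation "¬ phi" := (fnot phi) (at level 75, right associativity) : form_scope.
Infix "∧" := fand (at level 80, right associativity) : form_scope.
Infix "∨" := for_ (at level 85, right associativity) : form_scope.
Infix "⇒" := fimp (at level 90, right associativity) : form_scope.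
Infix "⇔" := fiff (at level 95, no associativity) : form_scope.

(** ** Substitution *)

Fixpoint tsubst (s : nat -> term) (t : term) : term :=
  match t with
  | tvar n => s n
  | tzero => tzero
  | tone => tone
  | tadd t u => tadd (tsubst s t) (tsubst s u)
  | tmul t u => tmul (tsubst s t) (tsubst s u)
  end.

Definition tshift : term -> term := tsubst (fun n => tvar (S n)).

Definition scons {A : Type} (a : A) (s : nat -> A) (n : nat) : A :=
  match n with O => a | S m => s m end.

(** [s] acts on the number variables and [r] renames the set variables. *)
Fixpoint fsubst (s : nat -> term) (r : nat -> nat) (phi : form) : form :=
  match phi with
  | fbot => fbot
  | feq t u => feq (tsubst s t) (tsubst s u)
  | flt t u => flt (tsubst s t) (tsubst s u)
  | fmem t X => fmem (tsubst s t) (r X)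
  | fimp phi psi => fimp (fsubst s r phi) (fsubst s r psi)
  | fall phi => fall (fsubst (scons (tvar O) (fun n => tshift (s n))) r phi)
  | fAll phi => fAll (fsubst s (scons O (fun X => S (r X))) phi)
  end.

Definition shift_num : form -> form := fsubst (fun n => tvar (S n)) (fun X => X).
Definition shift_set : form -> form := fsubst tvar S.

Definition inst_num (t : term) : form -> form := fsubst (scons t tvar) (fun X => X).
Definition inst_set (X : nat) : form -> form := fsubst tvar (scons X (fun Y => Y)).

(** ** Provability

    Classical natural deduction with equality on numbers.  A formula of the
    theory [T] may have free variables and then stands for its universal
    closure: unlike a hypothesis in [G], it puts no restriction on
    generalization. *)

Inductive prv (T : form -> Prop) : list form -> form -> Prop :=
| prv_ax G phi : T phi -> prv T G phi
| prv_hyp G phi : In phi G -> prv T G phi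
| prv_impI G phi psi : prv T (phi :: G) psi -> prv T G (phi ⇒ psi)
| prv_impE G phi psi : prv T G (phi ⇒ psi) -> prv T G phi -> prv T G psi
| prv_raa G phi : prv T ((¬ phi)%form :: G) fbot -> prv T G phi
| prv_allI G phi : prv T (map shift_num G) phi -> prv T G (fall phi)
| prv_allE G phi t : prv T G (fall phi) -> prv T G (inst_num t phi)
| prv_AllI G phi : prv T (map shift_set G) phi -> prv T G (fAll phi)
| prv_AllE G phi X : prv T G (fAll phi) -> prv T G (inst_set X phi)
| prv_eq_refl G t : prv T G (t ≐ t)
| prv_eq_subst G t u phi :
    prv T G (t ≐ u) -> prv T G (inst_num t phi) -> prv T G (inst_num u phi).

Notation "T ⊢ phi" := (prv T [] phi) (at level 99, phi at level 98).

(** ** The arithmetical classes *)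

(** In [Delta00_ball] the bound [t] is shifted, so that it does not mention the
    quantified variable.  Bounded existential quantifiers are obtained through
    negation. *)
Inductive Delta00 : form -> Prop :=
| Delta00_bot : Delta00 fbot
| Delta00_eq t u : Delta00 (t ≐ u)
| Delta00_lt t u : Delta00 (t < u)
| Delta00_mem t X : Delta00 (t ∈ X)
| Delta00_imp phi psi : Delta00 phi -> Delta00 psi -> Delta00 (phi ⇒ psi)
| Delta00_ball t phi :
    Delta00 phi -> Delta00 (fall (tvar 0 < tshift t ⇒ phi)).

Inductive Sigma01 : form -> Prop :=
| Sigma01_intro theta : Delta00 theta -> Sigma01 (fex theta).

Inductive Pi01 : form -> Prop :=
| Pi01_intro theta : Delta00 theta -> Pi01 (fall theta).

(** ** The axioms of RCA0 *)

Section BasicAxioms.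
Open Scope form_scope.
Let m := tvar 0.
Let n := tvar 1.

Inductive basic_axiom : form -> Prop :=
| ax_succ_neq0 : basic_axiom (¬ (m + 1 ≐ 0))
| ax_succ_inj : basic_axiom (m + 1 ≐ n + 1 ⇒ m ≐ n)
| ax_add0 : basic_axiom (m + 0 ≐ m)
| ax_addS : basic_axiom (m + (n + 1) ≐ (m + n) + 1)
| ax_mul0 : basic_axiom (m * 0 ≐ 0)
| ax_mulS : basic_axiom (m * (n + 1) ≐ m * n + m)
| ax_lt0 : basic_axiom (¬ (m < 0))
| ax_ltS : basic_axiom (m < n + 1 ⇔ (m < n ∨ m ≐ n)).
End BasicAxioms.

(** The formulas [phi] and [psi] may have further free variables of both sorts,
    which serve as parameters; the distinguished number variable is 0. *)

Definition induction_axiom (phi : form) : form :=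
  (inst_num 0 phi
     ∧ fall (phi ⇒ fsubst (scons (tvar 0 + 1) (fun n => tvar (S n))) (fun X => X) phi)
   ⇒ fall phi)%form.

Definition comprehension_axiom (phi psi : form) : form :=
  (fall (phi ⇔ psi) ⇒ fEx (fall (tvar 0 ∈ 0 ⇔ shift_set phi)))%form.

Inductive RCA0 : form -> Prop :=
| RCA0_basic phi : basic_axiom phi -> RCA0 phi
| RCA0_Sigma01_induction phi : Sigma01 phi -> RCA0 (induction_axiom phi)
| RCA0_Delta01_comprehension phi psi :
    Sigma01 phi -> Pi01 psi -> RCA0 (comprehension_axiom phi psi).

(** * Partial orders in second-order arithmetic

    A binary relation is coded as a set of pairs by means of the pairing
    function (m, n) = (m + n)^2 + m.  An order is given by two set variables:
    its domain [D] and its relation [R]. *)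

Definition pair (t u : term) : term := ((t + u) * (t + u) + t)%form.

Section Orders.
Open Scope form_scope.

(** Number variable 0 ranges over the elements of the set [D]. *)
Definition fall_in (D : nat) (phi : form) : form := fall (tvar 0 ∈ D ⇒ phi).
Definition fex_in (D : nat) (phi : form) : form := fex (tvar 0 ∈ D ∧ phi).

Definition rel (R : nat) (t u : term) : form := pair t u ∈ R.
Definition srel (R : nat) (t u : term) : form := rel R t u ∧ ¬ (t ≐ u).

Definition subset_prod (R D E : nat) : form :=
  fall (tvar 0 ∈ R ⇒
        fex_in D (fex_in E
          (let z := tvar 2 in let x := tvar 1 in let y := tvar 0 in
           z ≐ pair x y))).

Definition reflexive (D R : nat) : form :=
  fall_in D (let x := tvar 0 in rel R x x).

Definition transitive (D R : nat) : form :=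
  fall_in D (fall_in D (fall_in D
    (let x := tvar 2 in let y := tvar 1 in let z := tvar 0 in
     rel R x y ⇒ rel R y z ⇒ rel R x z))).

Definition antisymmetric (D R : nat) : form :=
  fall_in D (fall_in D
    (let x := tvar 1 in let y := tvar 0 in
     rel R x y ⇒ rel R y x ⇒ x ≐ y)).

Definition total (D R : nat) : form :=
  fall_in D (fall_in D
    (let x := tvar 1 in let y := tvar 0 in
     rel R x y ∨ rel R y x)).

Definition partial_order (D R : nat) : form :=
  subset_prod R D D ∧ reflexive D R ∧ transitive D R ∧ antisymmetric D R.

Definition linear_order (D R : nat) : form :=
  partial_order D R ∧ total D R.

Definition omits_2plus2 (D R : nat) : form :=
  fall_in D (fall_in D (fall_in D (fall_in D
    (let p0 := tvar 3 in let q0 := tvar 2 in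
     let p1 := tvar 1 in let q1 := tvar 0 in
     srel R p0 q0 ⇒ srel R p1 q1 ⇒ rel R p0 q1 ∨ rel R p1 q0)))).

Definition omits_3plus1 (D R : nat) : form :=
  fall_in D (fall_in D (fall_in D (fall_in D
    (let p0 := tvar 3 in let p1 := tvar 2 in
     let p2 := tvar 1 in let q := tvar 0 in
     srel R p0 p1 ⇒ srel R p1 p2 ⇒ rel R p0 q ∨ rel R q p2)))).

(** Below, [F] codes a subset of D × L, so that [rel F p x] says that x
    belongs to F(p). *)

Definition intervals_nonempty (D F : nat) : form :=
  fall_in D (fex (let p := tvar 1 in let x := tvar 0 in rel F p x)).

Definition intervals_convex (D L S F : nat) : form :=
  fall_in D (fall_in L (fall_in L (fall_in L
    (let p := tvar 3 in let x := tvar 2 in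
     let y := tvar 1 in let z := tvar 0 in
     rel F p x ⇒ rel F p y ⇒ srel S x z ⇒ srel S z y ⇒ rel F p z)))).

Definition intervals_represent (D R S F : nat) : form :=
  fall_in D (fall_in D
    (let p := tvar 1 in let q := tvar 0 in
     srel R p q ⇔
     fall (fall
       (let p := tvar 3 in let q := tvar 2 in
        let x := tvar 1 in let y := tvar 0 in
        rel F p x ⇒ rel F q y ⇒ srel S x y)))).

Definition intervals_proper (D F : nat) : form :=
  fall_in D (fall_in D
    (fall (let p := tvar 2 in let q := tvar 1 in let x := tvar 0 in
           rel F p x ⇒ rel F q x) ⇒
     fall (let p := tvar 2 in let q := tvar 1 in let x := tvar 0 in
           rel F p x ⇔ rel F q x))).

Definition proper_representation (D R L S F : nat) : form :=
  linear_order L S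
  ∧ subset_prod F D L
  ∧ intervals_nonempty D F
  ∧ intervals_convex D L S F
  ∧ intervals_represent D R S F
  ∧ intervals_proper D F.

(** Under the three set quantifiers the variables L, S, F are 2, 1, 0, and
    [D] and [R] are shifted by 3. *)
Definition proper_interval_order (D R : nat) : form :=
  fEx (fEx (fEx (proper_representation (3 + D) (3 + R) 2 1 0))).

End Orders.

(* Main.v *)
From Stdlib Require Import List Arith Lia Cantor Ring.
From Stdlib Require Import Classical ClassicalEpsilon FunctionalExtensionality
  PropExtensionality ProofIrrelevance.
Require Import Defs.
Import ListNotations.

(** By the completeness theorem it suffices to represent every semiorder [(D, ≺)]
    that is a set of a model of RCA0.  Say that [p] is below [q] at stage [s] if
    [o ≺ p -> o ≺ q] and [q ≺ o -> p ≺ o] for all [o < s].  The absence of 2+2 and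
    3+1 makes each stage a total preorder; the stages are decidable and become
    finer as [s] grows, but their limit is not decidable.

    A cut is therefore decided step by step.  Its seed [(s, e)] puts an element
    [v < s] into it if [v] is below [e] at stage [s]; each later [v] is put into it
    if at stage [v + 1] it is below some element put there before.  The resulting
    set is decidable and closed downwards in the limit preorder, and inclusion of
    cuts is decided by the elements that precede the seeds.

    The points of the linear order are the cuts [A] together with the cuts [C] of
    the reversed semiorder.  The interval of [p] consists of the [A] in which [p]
    is maximal and of the [C] in which [p] is minimal.  If [p] and [q] are
    incomparable, the cut of the greater one, seeded late enough, lies in both
    intervals.  If some stage distinguishes them, a cut of the smaller one and a
    reversed cut of the greater one show that neither interval contains the other;
    if no stage does, the two intervals coincide. *)

(** * Substitution *)

Definition up (s : nat -> term) : nat -> term :=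
  scons (tvar 0) (fun n => tshift (s n)).
Definition upset (r : nat -> nat) : nat -> nat := scons 0 (fun X => S (r X)).

Fixpoint num_bound_term (t : term) : nat :=
  match t with
  | tvar n => S n
  | tzero | tone => 0
  | tadd t u | tmul t u => Nat.max (num_bound_term t) (num_bound_term u)
  end.

Fixpoint num_bound (phi : form) : nat :=
  match phi with
  | fbot => 0
  | feq t u | flt t u => Nat.max (num_bound_term t) (num_bound_term u)
  | fmem t _ => num_bound_term t
  | fimp phi psi => Nat.max (num_bound phi) (num_bound psi)
  | fall phi => pred (num_bound phi)
  | fAll phi => num_bound phi
  end.

Fixpoint set_bound (phi : form) : nat :=
  match phi with
  | fbot | feq _ _ | flt _ _ => 0
  | fmem _ X => S X
  | fimp phi psi => Nat.max (set_bound phi) (set_bound psi)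
  | fall phi => set_bound phi
  | fAll phi => pred (set_bound phi)
  end.

Lemma tsubst_ext t s s' :
  (forall n, n < num_bound_term t -> s n = s' n) -> tsubst s t = tsubst s' t.
Proof.
  induction t; simpl; intros H; auto; f_equal; (apply IHt1 || apply IHt2);
    intros; apply H; lia.
Qed.

Lemma fsubst_ext phi : forall s s' r r',
  (forall n, n < num_bound phi -> s n = s' n) ->
  (forall X, X < set_bound phi -> r X = r' X) ->
  fsubst s r phi = fsubst s' r' phi.
Proof.
  induction phi; simpl; intros s s' r r' Hs Hr; auto.
  1-3: f_equal; auto; apply tsubst_ext; intros; apply Hs; lia.
  - f_equal; [apply IHphi1 | apply IHphi2];
      intros; (apply Hs || apply Hr); lia.
  - f_equal. apply IHphi; auto.
    intros [|n] Hn; simpl; auto. rewrite (Hs n); [reflexivity | lia].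
  - f_equal. apply IHphi; auto.
    intros [|n] Hn; simpl; auto. rewrite (Hr n); [reflexivity | lia].
Qed.

Lemma tsubst_comp s s' t :
  tsubst s (tsubst s' t) = tsubst (fun n => tsubst s (s' n)) t.
Proof. induction t; simpl; congruence. Qed.

Lemma tsubst_id t : tsubst tvar t = t.
Proof. induction t; simpl; congruence. Qed.

Lemma tsubst_scons_tshift u s t : tsubst (scons u s) (tshift t) = tsubst s t.
Proof. unfold tshift. rewrite tsubst_comp. reflexivity. Qed.

Lemma tsubst_up_tshift s t : tsubst (up s) (tshift t) = tshift (tsubst s t).
Proof. unfold tshift, up. rewrite !tsubst_comp. reflexivity. Qed.

Lemma fsubst_comp phi : forall s s' r r',
  fsubst s r (fsubst s' r' phi)
  = fsubst (fun n => tsubst s (s' n)) (fun X => r (r' X)) phi.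
Proof.
  induction phi; simpl; intros s s' r r'; rewrite ?tsubst_comp; auto.
  - now rewrite IHphi1, IHphi2.
  - f_equal. rewrite IHphi. apply fsubst_ext; auto.
    intros [|n] _; simpl; auto. apply tsubst_up_tshift.
  - f_equal. rewrite IHphi. apply fsubst_ext; auto.
    intros [|n] _; simpl; auto.
Qed.

Lemma fsubst_id phi : fsubst tvar (fun X => X) phi = phi.
Proof.
  induction phi; simpl; rewrite ?tsubst_id; auto.
  - now rewrite IHphi1, IHphi2.
  - f_equal. rewrite <- IHphi at 2. apply fsubst_ext; auto.
    intros [|n] _; auto.
  - f_equal. rewrite <- IHphi at 2. apply fsubst_ext; auto.
    intros [|n] _; auto.
Qed.

Lemma fsubst_inst_num s r t phi :
  fsubst s r (inst_num t phi) = inst_num (tsubst s t) (fsubst (up s) r phi).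
Proof.
  unfold inst_num. rewrite !fsubst_comp. apply fsubst_ext; auto.
  intros [|n] _; simpl; auto. now rewrite tsubst_scons_tshift, tsubst_id.
Qed.

Lemma fsubst_inst_set s r X phi :
  fsubst s r (inst_set X phi) = inst_set (r X) (fsubst s (upset r) phi).
Proof.
  unfold inst_set. rewrite !fsubst_comp. apply fsubst_ext; auto.
  - intros n _. simpl. now rewrite tsubst_id.
  - intros [|n] _; simpl; auto.
Qed.

Lemma inst_num_up s r t phi :
  inst_num t (fsubst (up s) r phi) = fsubst (scons t s) r phi.
Proof.
  unfold inst_num. rewrite fsubst_comp. apply fsubst_ext; auto.
  intros [|n] _; simpl; auto. now rewrite tsubst_scons_tshift, tsubst_id.
Qed.

Lemma inst_set_upset s r X phi :
  inst_set X (fsubst s (upset r) phi) = fsubst s (scons X r) phi.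
Proof.
  unfold inst_set. rewrite fsubst_comp. apply fsubst_ext.
  - intros n _. apply tsubst_id.
  - intros [|n] _; reflexivity.
Qed.

Lemma fsubst_up_shift_num s r phi :
  fsubst (up s) r (shift_num phi) = shift_num (fsubst s r phi).
Proof. unfold shift_num. rewrite !fsubst_comp. reflexivity. Qed.

Lemma fsubst_upset_shift_set s r phi :
  fsubst s (upset r) (shift_set phi) = shift_set (fsubst s r phi).
Proof.
  unfold shift_set. rewrite !fsubst_comp. apply fsubst_ext; auto.
  intros n _. simpl. now rewrite tsubst_id.
Qed.

(** * Derivations *)

Definition subst_stable (T : form -> Prop) : Prop :=
  forall phi s r, T phi -> T ⊢ fsubst s r phi.

Section Derivations.
Variable T : form -> Prop.

Lemma prv_weaken G phi : prv T G phi -> forall G', incl G G' -> prv T G' phi.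
Proof.
  induction 1; intros G' Hi.
  - now apply prv_ax.
  - apply prv_hyp; auto.
  - apply prv_impI, IHprv. intros x [<-|Hx]; simpl; auto.
  - eapply prv_impE; eauto.
  - apply prv_raa, IHprv. intros x [<-|Hx]; simpl; auto.
  - apply prv_allI, IHprv, incl_map, Hi.
  - apply prv_allE; auto.
  - apply prv_AllI, IHprv, incl_map, Hi.
  - apply prv_AllE; auto.
  - apply prv_eq_refl.
  - eapply prv_eq_subst; eauto.
Qed.

Lemma prv_cut G phi psi : prv T G phi -> prv T (phi :: G) psi -> prv T G psi.
Proof. intros H1 H2. eapply prv_impE; [apply prv_impI, H2 | exact H1]. Qed.

Lemma prv_exfalso G phi : prv T G fbot -> prv T G phi.
Proof.
  intros H. apply prv_raa. apply (prv_weaken _ _ H). intros x Hx; now right.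
Qed.

Lemma prv_eq_sym G t u : prv T G (t ≐ u)%form -> prv T G (u ≐ t)%form.
Proof.
  intros H.
  assert (E : prv T G (inst_num u (tvar 0 ≐ tshift t)%form)).
  { apply (prv_eq_subst T G t); [exact H|]. unfold inst_num; simpl.
    rewrite tsubst_scons_tshift, tsubst_id. apply prv_eq_refl. }
  unfold inst_num in E; simpl in E.
  now rewrite tsubst_scons_tshift, tsubst_id in E.
Qed.

Hypothesis Tsub : subst_stable T.

Lemma prv_subst G phi : prv T G phi ->
  forall s r, prv T (map (fsubst s r) G) (fsubst s r phi).
Proof.
  induction 1; intros s r; simpl in *.
  - apply (prv_weaken [] _ (Tsub phi s r H)). intros x [].
  - apply prv_hyp, in_map, H.
  - apply prv_impI, IHprv.
  - eapply prv_impE; [apply IHprv1 | apply IHprv2].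
  - apply prv_raa, IHprv.
  - apply prv_allI. specialize (IHprv (up s) r).
    rewrite map_map in *. erewrite map_ext; [exact IHprv|].
    intros a. symmetry. apply fsubst_up_shift_num.
  - rewrite fsubst_inst_num. apply prv_allE, IHprv.
  - apply prv_AllI. specialize (IHprv s (upset r)).
    rewrite map_map in *. erewrite map_ext; [exact IHprv|].
    intros a. symmetry. apply fsubst_upset_shift_set.
  - rewrite fsubst_inst_set. apply prv_AllE, IHprv.
  - apply prv_eq_refl.
  - rewrite fsubst_inst_num. apply prv_eq_subst with (tsubst s t); auto.
    rewrite <- fsubst_inst_num. auto.
Qed.

Lemma prv_allI_fresh G phi x :
  (forall psi, In psi (fall phi :: G) -> num_bound psi <= x) ->
  prv T G (inst_num (tvar x) phi) -> prv T G (fall phi).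
Proof.
  intros Hx H. apply prv_allI.
  set (s := fun n => if n =? x then tvar 0 else tvar (S n)).
  apply (fun H => prv_subst _ _ H s (fun X => X)) in H.
  unfold inst_num in H. rewrite fsubst_comp in H.
  replace (map shift_num G) with (map (fsubst s (fun X => X)) G).
  - rewrite <- (fsubst_id phi). erewrite fsubst_ext; [exact H| |auto].
    specialize (Hx (fall phi) (or_introl eq_refl)). simpl in Hx.
    intros [|n] Hn; simpl; unfold s.
    + now rewrite Nat.eqb_refl.
    + destruct (Nat.eqb_spec n x); [lia | auto].
  - apply map_ext_in. intros a Ha. apply fsubst_ext; auto.
    intros n Hn. unfold s. specialize (Hx a (or_intror Ha)).
    destruct (Nat.eqb_spec n x); [lia | auto].
Qed.

Lemma prv_AllI_fresh G phi X :
  (forall psi, In psi (fAll phi :: G) -> set_bound psi <= X) ->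
  prv T G (inst_set X phi) -> prv T G (fAll phi).
Proof.
  intros HX H. apply prv_AllI.
  set (r := fun n => if n =? X then 0 else S n).
  apply (fun H => prv_subst _ _ H tvar r) in H.
  unfold inst_set in H. rewrite fsubst_comp in H.
  replace (map shift_set G) with (map (fsubst tvar r) G).
  - rewrite <- (fsubst_id phi). erewrite fsubst_ext; [exact H| |].
    + reflexivity.
    + specialize (HX (fAll phi) (or_introl eq_refl)). simpl in HX.
      intros [|n] Hn; simpl; unfold r.
      * now rewrite Nat.eqb_refl.
      * destruct (Nat.eqb_spec n X); [lia | auto].
  - apply map_ext_in. intros a Ha. apply fsubst_ext; auto.
    intros n Hn. unfold r. specialize (HX a (or_intror Ha)).
    destruct (Nat.eqb_spec n X); [lia | auto].
Qed.

End Derivations.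

(** * Models *)

Record model := Model {
  num : Type;
  set : Type;
  zero : num;
  one : num;
  add : num -> num -> num;
  mul : num -> num -> num;
  lt : num -> num -> Prop;
  mem : num -> set -> Prop }.

Fixpoint eval (M : model) (s : nat -> num M) (t : term) : num M :=
  match t with
  | tvar n => s n
  | tzero => zero M
  | tone => one M
  | tadd t u => add M (eval M s t) (eval M s u)
  | tmul t u => mul M (eval M s t) (eval M s u)
  end.

Fixpoint sat (M : model) (s : nat -> num M) (r : nat -> set M) (phi : form)
  : Prop :=
  match phi with
  | fbot => False
  | feq t u => eval M s t = eval M s u
  | flt t u => lt M (eval M s t) (eval M s u)
  | fmem t X => mem M (eval M s t) (r X)
  | fimp phi psi => sat M s r phi -> sat M s r psi
  | fall phi => forall x, sat M (scons x s) r phi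
  | fAll phi => forall X, sat M s (scons X r) phi
  end.

Definition satisfies (M : model) (T : form -> Prop) : Prop :=
  forall phi, T phi -> forall s r, sat M s r phi.

Lemma scons_comp {A B : Type} (f : A -> B) a s :
  scons (f a) (fun n => f (s n)) = (fun n => f (scons a s n)).
Proof. apply functional_extensionality. now intros [|n]. Qed.

Section Semantics.
Variable M : model.

Lemma eval_tsubst s s' t :
  eval M s (tsubst s' t) = eval M (fun n => eval M s (s' n)) t.
Proof. induction t; simpl; congruence. Qed.

Lemma eval_tshift x s t : eval M (scons x s) (tshift t) = eval M s t.
Proof. unfold tshift. rewrite eval_tsubst. reflexivity. Qed.

Lemma sat_fsubst phi : forall s r s' r',
  sat M s r (fsubst s' r' phi)
  <-> sat M (fun n => eval M s (s' n)) (fun X => r (r' X)) phi.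
Proof.
  induction phi; simpl; intros s r s' r'; rewrite ?eval_tsubst.
  1-4: reflexivity.
  - rewrite IHphi1, IHphi2. reflexivity.
  - assert (E : forall x,
      (fun n => eval M (scons x s) (scons (tvar 0) (fun n => tshift (s' n)) n))
      = scons x (fun n => eval M s (s' n))).
    { intros x. apply functional_extensionality. intros [|n]; simpl; auto.
      apply eval_tshift. }
    split; intros H x.
    + rewrite <- E. apply IHphi, H.
    + apply IHphi. simpl. rewrite E. apply H.
  - assert (E : forall X,
      (fun Y => scons X r (scons 0 (fun Y => S (r' Y)) Y))
      = scons X (fun Y => r (r' Y))).
    { intros X. apply functional_extensionality. now intros [|n]. }
    split; intros H X.
    + rewrite <- E. apply (IHphi s (scons X r)), H.
    + apply IHphi. simpl. rewrite E. apply H.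
Qed.

Lemma sat_inst_num s r t phi :
  sat M s r (inst_num t phi) <-> sat M (scons (eval M s t) s) r phi.
Proof.
  unfold inst_num. rewrite sat_fsubst.
  rewrite <- (scons_comp (eval M s) t tvar). reflexivity.
Qed.

Lemma sat_shift_set X s r phi :
  sat M s (scons X r) (shift_set phi) <-> sat M s r phi.
Proof. unfold shift_set. rewrite sat_fsubst. reflexivity. Qed.

Lemma sat_and s r phi psi :
  sat M s r (phi ∧ psi)%form <-> sat M s r phi /\ sat M s r psi.
Proof. simpl. tauto. Qed.

Lemma sat_or s r phi psi :
  sat M s r (phi ∨ psi)%form <-> sat M s r phi \/ sat M s r psi.
Proof. simpl. tauto. Qed.

Lemma sat_iff s r phi psi :
  sat M s r (phi ⇔ psi)%form <-> (sat M s r phi <-> sat M s r psi).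
Proof. simpl. tauto. Qed.

Lemma sat_ex s r phi :
  sat M s r (fex phi) <-> exists x, sat M (scons x s) r phi.
Proof.
  simpl. split.
  - intros H. apply NNPP. intros H'. apply H. intros x Hx. eauto.
  - intros [x Hx] H. exact (H x Hx).
Qed.

Lemma sat_Ex s r phi :
  sat M s r (fEx phi) <-> exists X, sat M s (scons X r) phi.
Proof.
  simpl. split.
  - intros H. apply NNPP. intros H'. apply H. intros X HX. eauto.
  - intros [X HX] H. exact (H X HX).
Qed.

End Semantics.

(** * Completeness *)

Fixpoint code_term (t : term) : nat :=
  match t with
  | tvar n => to_nat (0, n)
  | tzero => to_nat (1, 0)
  | tone => to_nat (2, 0)
  | tadd t u => to_nat (3, to_nat (code_term t, code_term u))
  | tmul t u => to_nat (4, to_nat (code_term t, code_term u))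
  end.

Fixpoint code_form (phi : form) : nat :=
  match phi with
  | fbot => to_nat (0, 0)
  | feq t u => to_nat (1, to_nat (code_term t, code_term u))
  | flt t u => to_nat (2, to_nat (code_term t, code_term u))
  | fmem t X => to_nat (3, to_nat (code_term t, X))
  | fimp phi psi => to_nat (4, to_nat (code_form phi, code_form psi))
  | fall phi => to_nat (5, code_form phi)
  | fAll phi => to_nat (6, code_form phi)
  end.

Lemma to_nat_pair_inj a b c d : to_nat (a, b) = to_nat (c, d) -> a = c /\ b = d.
Proof. intros H. apply to_nat_inj in H. now injection H. Qed.

Ltac split_code :=
  repeat match goal with
  | H : to_nat _ = to_nat _ |- _ => apply to_nat_pair_inj in H as [? ?]
  end.

Lemma code_term_inj t : forall u, code_term t = code_term u -> t = u.
Proof.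
  induction t; intros []; cbn [code_term]; intros H; split_code;
    try discriminate; f_equal; auto.
Qed.

Lemma code_form_inj phi : forall psi, code_form phi = code_form psi -> phi = psi.
Proof.
  induction phi; intros []; cbn [code_form]; intros H; split_code;
    try discriminate; f_equal; auto using code_term_inj.
Qed.

Definition form_of_nat (n : nat) : form :=
  epsilon (inhabits fbot) (fun phi => code_form phi = n).

Lemma form_of_nat_code phi : form_of_nat (code_form phi) = phi.
Proof. apply code_form_inj. unfold form_of_nat. apply epsilon_spec. eauto. Qed.

Definition list_bound (b : form -> nat) (G : list form) : nat :=
  list_max (map b G).

Lemma list_bound_le b G phi : In phi G -> b phi <= list_bound b G.
Proof.
  intros H.
  assert (HF := proj1 (list_max_le (map b G) (list_bound b G)) (le_n _)).
  rewrite Forall_forall in HF. apply HF, in_map, H.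
Qed.

Section Henkin.
Variable T : form -> Prop.
Hypothesis Tsub : subst_stable T.
Variable phi0 : form.
Hypothesis unprovable : ~ (T ⊢ phi0).

Definition consistent (G : list form) : Prop := ~ prv T G fbot.

(* A rejected universal formula gets a counterexample at a variable that is
   fresh for the finitely many formulas accepted so far. *)
Definition extend (G : list form) (phi : form) : list form :=
  if excluded_middle_informative (consistent (phi :: G)) then phi :: G
  else
    let G' := ((¬ phi)%form :: G) in
    match phi with
    | fall psi =>
        (¬ inst_num (tvar (list_bound num_bound G')) psi)%form :: G'
    | fAll psi => (¬ inst_set (list_bound set_bound G') psi)%form :: G'
    | _ => G'
    end.

Lemma consistent_not G phi :
  consistent G -> ~ consistent (phi :: G) -> consistent ((¬ phi)%form :: G).
Proof.
  intros HG Hphi H. apply Hphi. intros H'. apply HG.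
  apply (prv_cut T G (¬ phi)%form); [apply prv_impI, H' | exact H].
Qed.

Lemma consistent_extend G phi : consistent G -> consistent (extend G phi).
Proof.
  intros HG. unfold extend.
  destruct (excluded_middle_informative _) as [H|H]; auto.
  pose proof (consistent_not G phi HG H) as Hn.
  destruct phi; auto; intros C; apply Hn; apply prv_raa in C;
    eapply prv_impE; try (apply prv_hyp; left; reflexivity).
  - apply prv_allI_fresh with (3 := C); [exact Tsub|].
    intros psi [<-|Hp]; [|now apply list_bound_le].
    rewrite <- (Nat.max_0_r (num_bound (fall phi))).
    apply (list_bound_le num_bound (_ :: G) (¬ fall phi)%form). now left.
  - apply prv_AllI_fresh with (3 := C); [exact Tsub|].
    intros psi [<-|Hp]; [|now apply list_bound_le].
    rewrite <- (Nat.max_0_r (set_bound (fAll phi))).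
    apply (list_bound_le set_bound (_ :: G) (¬ fAll phi)%form). now left.
Qed.

Fixpoint chain (n : nat) : list form :=
  match n with
  | 0 => [(¬ phi0)%form]
  | S n => extend (chain n) (form_of_nat n)
  end.

Lemma consistent_chain n : consistent (chain n).
Proof.
  induction n; simpl; [|now apply consistent_extend].
  intros H. apply unprovable, prv_raa, H.
Qed.

Lemma incl_extend G phi : incl G (extend G phi).
Proof.
  intros x Hx. unfold extend.
  destruct (excluded_middle_informative _); [now right|].
  destruct phi; simpl; auto.
Qed.

Lemma incl_chain m n : m <= n -> incl (chain m) (chain n).
Proof.
  induction 1; [apply incl_refl|].
  eapply incl_tran; [eassumption | apply incl_extend].
Qed.

Definition Omega (phi : form) : Prop := exists n, prv T (chain n) phi.

Lemma Omega_T phi : T ⊢ phi -> Omega phi.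
Proof. intros H. exists 0. apply (prv_weaken _ _ _ H). intros x []. Qed.

Lemma Omega_MP phi psi : Omega (phi ⇒ psi)%form -> Omega phi -> Omega psi.
Proof.
  intros [m Hm] [n Hn]. exists (m + n). apply prv_impE with phi;
    eapply prv_weaken; try eassumption; apply incl_chain; lia.
Qed.

Lemma Omega_bot : ~ Omega fbot.
Proof. intros [n H]. exact (consistent_chain n H). Qed.

Lemma Omega_decides phi : Omega phi \/ Omega (¬ phi)%form.
Proof.
  assert (H : forall n, chain (S n) = extend (chain n) (form_of_nat n))
    by reflexivity.
  specialize (H (code_form phi)). rewrite form_of_nat_code in H.
  unfold extend in H. destruct (excluded_middle_informative _).
  - left. exists (S (code_form phi)). rewrite H. apply prv_hyp. now left.
  - right. exists (S (code_form phi)). rewrite H. apply prv_hyp.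
    destruct phi; simpl; auto.
Qed.

Lemma Omega_imp phi psi :
  Omega (phi ⇒ psi)%form <-> (Omega phi -> Omega psi).
Proof.
  split; [apply Omega_MP|]. intros H.
  destruct (Omega_decides phi) as [Hp|[n Hn]].
  - destruct (H Hp) as [n Hn]. exists n. apply prv_impI.
    apply (prv_weaken _ _ _ Hn). intros x Hx; now right.
  - exists n. apply prv_impI, prv_exfalso.
    apply prv_impE with phi; [|apply prv_hyp; now left].
    apply (prv_weaken _ _ _ Hn). intros x Hx; now right.
Qed.

Lemma Omega_all phi : Omega (fall phi) <-> forall t, Omega (inst_num t phi).
Proof.
  split.
  - intros [n H] t. exists n. now apply prv_allE.
  - intros H. set (n := code_form (fall phi)).
    assert (E : chain (S n) = extend (chain n) (fall phi))
      by (simpl; unfold n; now rewrite form_of_nat_code).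
    unfold extend in E. destruct (excluded_middle_informative _).
    + exists (S n). rewrite E. apply prv_hyp. now left.
    + destruct Omega_bot. eapply Omega_MP; [|apply H].
      exists (S n). rewrite E. apply prv_hyp. left. reflexivity.
Qed.

Lemma Omega_All phi : Omega (fAll phi) <-> forall X, Omega (inst_set X phi).
Proof.
  split.
  - intros [n H] X. exists n. now apply prv_AllE.
  - intros H. set (n := code_form (fAll phi)).
    assert (E : chain (S n) = extend (chain n) (fAll phi))
      by (simpl; unfold n; now rewrite form_of_nat_code).
    unfold extend in E. destruct (excluded_middle_informative _).
    + exists (S n). rewrite E. apply prv_hyp. now left.
    + destruct Omega_bot. eapply Omega_MP; [|apply H].
      exists (S n). rewrite E. apply prv_hyp. left. reflexivity.
Qed.

Lemma Omega_refl t : Omega (t ≐ t)%form.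
Proof. exists 0. apply prv_eq_refl. Qed.

Lemma Omega_sym t u : Omega (t ≐ u)%form -> Omega (u ≐ t)%form.
Proof. intros [n H]. exists n. now apply prv_eq_sym. Qed.

Lemma Omega_rewrite t u phi :
  Omega (t ≐ u)%form -> Omega (inst_num t phi) -> Omega (inst_num u phi).
Proof.
  intros [m Hm] [n Hn]. exists (m + n). apply prv_eq_subst with t;
    eapply prv_weaken; try eassumption; apply incl_chain; lia.
Qed.

Lemma Omega_trans t u v :
  Omega (t ≐ u)%form -> Omega (u ≐ v)%form -> Omega (t ≐ v)%form.
Proof.
  intros Htu Huv.
  apply (Omega_rewrite u v (tshift t ≐ tvar 0)%form) in Huv;
    unfold inst_num in *; simpl in *;
    rewrite tsubst_scons_tshift, tsubst_id in *; auto.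
Qed.

Definition rep (t : term) : term :=
  epsilon (inhabits t) (fun u => Omega (t ≐ u)%form).

Lemma rep_spec t : Omega (t ≐ rep t)%form.
Proof. unfold rep. apply epsilon_spec. exists t. apply Omega_refl. Qed.

Lemma rep_eq t u : rep t = rep u <-> Omega (t ≐ u)%form.
Proof.
  split; intros H.
  - apply Omega_trans with (rep t); [apply rep_spec|].
    rewrite H. apply Omega_sym, rep_spec.
  - unfold rep.
    replace (fun v => Omega (t ≐ v)%form) with (fun v => Omega (u ≐ v)%form).
    + f_equal. apply proof_irrelevance.
    + apply functional_extensionality. intros v.
      apply propositional_extensionality. split; intros H'.
      * now apply Omega_trans with u.
      * apply Omega_trans with t; [now apply Omega_sym | exact H'].
Qed.

Definition henkin_num : Type := { t : term | rep t = t }.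

Definition cls (t : term) : henkin_num :=
  exist _ (rep t) (proj2 (rep_eq (rep t) t) (Omega_sym _ _ (rep_spec t))).

Lemma cls_eq t u : cls t = cls u <-> Omega (t ≐ u)%form.
Proof.
  rewrite <- rep_eq. split; intros H.
  - now apply (f_equal (@proj1_sig _ _)) in H.
  - now apply subset_eq_compat.
Qed.

Lemma cls_proj1_sig d : cls (proj1_sig d) = d.
Proof. destruct d as [t Ht]. now apply subset_eq_compat. Qed.

Definition henkin : model :=
  {| num := henkin_num;
     set := nat;
     zero := cls tzero;
     one := cls tone;
     add := fun a b => cls (tadd (proj1_sig a) (proj1_sig b));
     mul := fun a b => cls (tmul (proj1_sig a) (proj1_sig b));
     lt := fun a b => Omega (flt (proj1_sig a) (proj1_sig b));
     mem := fun a X => Omega (fmem (proj1_sig a) X) |}.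

Lemma Omega_congr_form (f : term -> term -> form)
  (Hf : forall s t u, fsubst s (fun X => X) (f t u)
                      = f (tsubst s t) (tsubst s u)) t u t' u' :
  Omega (t ≐ t')%form -> Omega (u ≐ u')%form -> Omega (f t u) -> Omega (f t' u').
Proof.
  intros Ht Hu H.
  apply (Omega_rewrite t t' (f (tvar 0) (tshift u))) in Ht.
  - apply (Omega_rewrite u u' (f (tshift t') (tvar 0))) in Hu;
      unfold inst_num in *; rewrite Hf in *; simpl in *;
      rewrite tsubst_scons_tshift, tsubst_id in *; auto.
  - unfold inst_num; rewrite Hf; simpl.
    now rewrite tsubst_scons_tshift, tsubst_id.
Qed.

Lemma Omega_congr_term (f : term -> term -> term)
  (Hf : forall s t u, tsubst s (f t u) = f (tsubst s t) (tsubst s u)) t u t' u' :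
  Omega (t ≐ t')%form -> Omega (u ≐ u')%form -> Omega (f t u ≐ f t' u')%form.
Proof.
  assert (E : forall t t' u, Omega (t ≐ t')%form ->
    Omega (f t u ≐ f t' u)%form /\ Omega (f u t ≐ f u t')%form).
  { clear t u t' u'. intros t t' u H. split.
    - apply (Omega_rewrite t t' (f (tshift t) (tshift u) ≐ f (tvar 0) (tshift u))%form) in H;
        unfold inst_num in *; simpl in *; rewrite !Hf in *;
        simpl in *; rewrite !tsubst_scons_tshift, !tsubst_id in *;
        auto using Omega_refl.
    - apply (Omega_rewrite t t' (f (tshift u) (tshift t) ≐ f (tshift u) (tvar 0))%form) in H;
        unfold inst_num in *; simpl in *; rewrite !Hf in *;
        simpl in *; rewrite !tsubst_scons_tshift, !tsubst_id in *;
        auto using Omega_refl. }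
  intros Ht Hu. apply Omega_trans with (f t' u); [apply E, Ht | apply E, Hu].
Qed.

Lemma eval_henkin s t : eval henkin (fun n => cls (s n)) t = cls (tsubst s t).
Proof.
  induction t; simpl; auto; rewrite IHt1, IHt2; apply cls_eq;
    (apply (Omega_congr_term tadd) || apply (Omega_congr_term tmul));
    auto; apply Omega_sym, rep_spec.
Qed.

Lemma Omega_rep_form (f : term -> term -> form)
  (Hf : forall s t u, fsubst s (fun X => X) (f t u)
                      = f (tsubst s t) (tsubst s u)) t u :
  Omega (f (rep t) (rep u)) <-> Omega (f t u).
Proof.
  split; apply Omega_congr_form; auto using rep_spec, Omega_sym.
Qed.

Lemma sat_henkin phi : forall s r,
  sat henkin (fun n => cls (s n)) r phi <-> Omega (fsubst s r phi).
Proof.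
  induction phi; intros s r; simpl sat; rewrite ?eval_henkin.
  - split; [intros [] | apply Omega_bot].
  - apply cls_eq.
  - apply (Omega_rep_form flt). reflexivity.
  - apply (Omega_rep_form (fun t _ => fmem t (r X)) (fun _ _ _ => eq_refl) _ tzero).
  - simpl. now rewrite Omega_imp, IHphi1, IHphi2.
  - simpl. rewrite Omega_all. split.
    + intros H t. specialize (H (cls t)). rewrite scons_comp in H.
      apply IHphi in H. now rewrite <- inst_num_up in H.
    + intros H d. specialize (H (proj1_sig d)).
      rewrite <- (cls_proj1_sig d). rewrite scons_comp. apply IHphi.
      rewrite <- inst_num_up. exact H.
  - simpl. rewrite Omega_All. split; intros H X; specialize (H X).
    + apply IHphi in H. now rewrite <- inst_set_upset in H.
    + apply IHphi. rewrite <- inst_set_upset. exact H.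
Qed.

Lemma assignment_cls (s : nat -> henkin_num) :
  s = fun n => cls (proj1_sig (s n)).
Proof.
  apply functional_extensionality. intros n. symmetry. apply cls_proj1_sig.
Qed.

Lemma henkin_satisfies : satisfies henkin T.
Proof.
  intros phi H s r. rewrite (assignment_cls s). apply sat_henkin, Omega_T.
  now apply Tsub.
Qed.

Lemma henkin_refutes : ~ forall s r, sat henkin s r phi0.
Proof.
  intros H. specialize (H (fun n => cls (tvar n)) (fun X => X)).
  apply sat_henkin in H. rewrite fsubst_id in H. apply Omega_bot.
  apply Omega_MP with phi0; [|exact H].
  exists 0. apply prv_hyp. now left.
Qed.

End Henkin.

Theorem completeness (T : form -> Prop) (phi : form) :
  subst_stable T ->
  (forall M, satisfies M T -> forall s r, sat M s r phi) -> T ⊢ phi.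
Proof.
  intros HT H. apply NNPP. intros Hn.
  apply (henkin_refutes T HT phi Hn), H, henkin_satisfies; assumption.
Qed.

(** * Stability of the axioms under substitution *)

Lemma Delta00_fsubst phi : Delta00 phi -> forall s r, Delta00 (fsubst s r phi).
Proof.
  induction 1; intros s r; simpl; try constructor; auto.
  fold (up s). rewrite tsubst_up_tshift. constructor. auto.
Qed.

Lemma fsubst_induction_axiom s r phi :
  fsubst s r (induction_axiom phi) = induction_axiom (fsubst (up s) r phi).
Proof.
  unfold induction_axiom, fand, fnot. simpl. rewrite fsubst_inst_num.
  fold (up s). rewrite !fsubst_comp. repeat f_equal.
  apply functional_extensionality. intros [|n]; simpl; auto.
  unfold tshift. rewrite !tsubst_comp. reflexivity.
Qed.

Lemma fsubst_comprehension_axiom s r phi psi :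
  fsubst s r (comprehension_axiom phi psi)
  = comprehension_axiom (fsubst (up s) r phi) (fsubst (up s) r psi).
Proof.
  unfold comprehension_axiom, fEx, fiff, fand, fnot. simpl.
  fold (up s) (upset r). now rewrite !fsubst_upset_shift_set.
Qed.

Lemma RCA0_subst_stable : subst_stable RCA0.
Proof.
  intros phi s r H. destruct H as [phi H|phi H|phi psi H1 H2].
  - replace (fsubst s r phi)
      with (inst_num (s 0) (fsubst (up (scons (s 1) tvar)) (fun X => X) phi)).
    + apply prv_allE. change (fall _) with (inst_num (s 1) (fall phi)).
      apply prv_allE, prv_allI, prv_allI. simpl. apply prv_ax.
      now constructor.
    + rewrite inst_num_up. apply fsubst_ext.
      * assert (num_bound phi <= 2) by (destruct H; simpl; lia).
        intros [|[|n]] Hn; simpl; auto; lia.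
      * assert (set_bound phi = 0) by (destruct H; reflexivity).
        intros X HX. lia.
  - rewrite fsubst_induction_axiom.
    apply prv_ax, RCA0_Sigma01_induction.
    destruct H; simpl; constructor; now apply Delta00_fsubst.
  - rewrite fsubst_comprehension_axiom.
    apply prv_ax, RCA0_Delta01_comprehension.
    + destruct H1; simpl; constructor; now apply Delta00_fsubst.
    + destruct H2; simpl; constructor; now apply Delta00_fsubst.
Qed.

(** * Definability in a model *)

Definition weave {A : Type} (f g : nat -> A) (n : nat) : A :=
  if Nat.even n then f (Nat.div2 n) else g (Nat.div2 n).

Lemma weave_even {A : Type} (f g : nat -> A) n : weave f g (2 * n) = f n.
Proof.
  unfold weave. rewrite Nat.div2_double.
  now replace (Nat.even (2 * n)) with true by (symmetry; apply Nat.even_even).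
Qed.

Lemma weave_odd {A : Type} (f g : nat -> A) n : weave f g (S (2 * n)) = g n.
Proof.
  unfold weave. rewrite Nat.div2_succ_double.
  replace (Nat.even (S (2 * n))) with false; [reflexivity|].
  symmetry. rewrite Nat.even_succ, <- Nat.negb_even, Nat.even_even. reflexivity.
Qed.

Section Definability.
Variable M : model.
Local Notation N := (num M).

(* [v] says for each variable of a formula whether it is a parameter from the
   model or a variable of the environment [s]. *)
Definition assign (v : nat -> N + nat) (s : nat -> N) (n : nat) : N :=
  match v n with inl c => c | inr k => s k end.

Definition Delta (P : (nat -> N) -> Prop) : Prop :=
  exists phi v r, Delta00 phi /\ forall s, P s <-> sat M (assign v s) r phi.

Definition Term (f : (nat -> N) -> N) : Prop :=
  exists t v, forall s, f s = eval M (assign v s) t.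

Lemma assign_weave v v' s :
  assign (weave v v') s = weave (assign v s) (assign v' s).
Proof.
  apply functional_extensionality. intros n. unfold assign, weave.
  now destruct (Nat.even n).
Qed.

Definition to_even (n : nat) : term := tvar (2 * n).
Definition to_odd (n : nat) : term := tvar (S (2 * n)).

Lemma eval_to_even s s' t : eval M (weave s s') (tsubst to_even t) = eval M s t.
Proof.
  rewrite eval_tsubst. f_equal. apply functional_extensionality. intros n.
  apply weave_even.
Qed.

Lemma eval_to_odd s s' t : eval M (weave s s') (tsubst to_odd t) = eval M s' t.
Proof.
  rewrite eval_tsubst. f_equal. apply functional_extensionality. intros n.
  apply weave_odd.
Qed.

Lemma sat_to_even s s' r r' phi :
  sat M (weave s s') (weave r r') (fsubst to_even (fun X => 2 * X) phi)
  <-> sat M s r phi.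
Proof.
  rewrite sat_fsubst.
  replace (fun n => eval M (weave s s') (to_even n)) with s
    by (apply functional_extensionality; intros n; symmetry; apply weave_even).
  replace (fun X => weave r r' (2 * X)) with r; [reflexivity|].
  apply functional_extensionality; intros n; symmetry; apply weave_even.
Qed.

Lemma sat_to_odd s s' r r' phi :
  sat M (weave s s') (weave r r') (fsubst to_odd (fun X => S (2 * X)) phi)
  <-> sat M s' r' phi.
Proof.
  rewrite sat_fsubst.
  replace (fun n => eval M (weave s s') (to_odd n)) with s'
    by (apply functional_extensionality; intros n; symmetry; apply weave_odd).
  replace (fun X => weave r r' (S (2 * X))) with r'; [reflexivity|].
  apply functional_extensionality; intros n; symmetry; apply weave_odd.
Qed.

Lemma Term_var k : Term (fun s => s k).
Proof. exists (tvar 0), (fun _ => inr k). reflexivity. Qed.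

Lemma Term_rename f (q : nat -> nat) :
  Term f -> Term (fun s => f (fun n => s (q n))).
Proof.
  intros (t & v & Ht).
  exists t, (fun n => match v n with inl c => inl c | inr k => inr (q k) end).
  intros s. rewrite Ht. f_equal. apply functional_extensionality. intros n.
  unfold assign. now destruct (v n).
Qed.

Lemma Term_const c : Term (fun _ => c).
Proof. exists (tvar 0), (fun _ => inl c). reflexivity. Qed.

Lemma Term_add f g : Term f -> Term g -> Term (fun s => add M (f s) (g s)).
Proof.
  intros (t & v & Ht) (u & w & Hu).
  exists (tadd (tsubst to_even t) (tsubst to_odd u)), (weave v w).
  intros s. simpl. now rewrite assign_weave, eval_to_even, eval_to_odd, Ht, Hu.
Qed.

Lemma Term_mul f g : Term f -> Term g -> Term (fun s => mul M (f s) (g s)).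
Proof.
  intros (t & v & Ht) (u & w & Hu).
  exists (tmul (tsubst to_even t) (tsubst to_odd u)), (weave v w).
  intros s. simpl. now rewrite assign_weave, eval_to_even, eval_to_odd, Ht, Hu.
Qed.

Definition pr (a b : N) : N := add M (mul M (add M a b) (add M a b)) a.

Lemma Term_pr f g : Term f -> Term g -> Term (fun s => pr (f s) (g s)).
Proof. intros Hf Hg. unfold pr. auto using Term_add, Term_mul. Qed.

Lemma Delta_ext P Q : (forall s, P s <-> Q s) -> Delta P -> Delta Q.
Proof.
  intros H (phi & v & r & Hphi & HP). exists phi, v, r. split; auto.
  intros s. now rewrite <- H, HP.
Qed.

Lemma Delta_imp P Q : Delta P -> Delta Q -> Delta (fun s => P s -> Q s).
Proof.
  intros (phi & v & r & Hphi & HP) (psi & w & q & Hpsi & HQ).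
  exists (fimp (fsubst to_even (fun X => 2 * X) phi)
               (fsubst to_odd (fun X => S (2 * X)) psi)), (weave v w), (weave r q).
  split; [constructor; now apply Delta00_fsubst|].
  intros s. cbn [sat]. rewrite assign_weave, sat_to_even, sat_to_odd, HP, HQ.
  reflexivity.
Qed.

Variable X0 : set M.

Lemma Delta_bot : Delta (fun _ => False).
Proof.
  exists fbot, (fun n => inr n), (fun _ => X0). split; [constructor|].
  reflexivity.
Qed.

Lemma Delta_eq f g : Term f -> Term g -> Delta (fun s => f s = g s).
Proof.
  intros (t & v & Ht) (u & w & Hu).
  exists (feq (tsubst to_even t) (tsubst to_odd u)), (weave v w), (fun _ => X0).
  split; [constructor|]. intros s. simpl.
  now rewrite assign_weave, eval_to_even, eval_to_odd, Ht, Hu.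
Qed.

Lemma Delta_lt f g : Term f -> Term g -> Delta (fun s => lt M (f s) (g s)).
Proof.
  intros (t & v & Ht) (u & w & Hu).
  exists (flt (tsubst to_even t) (tsubst to_odd u)), (weave v w), (fun _ => X0).
  split; [constructor|]. intros s. simpl.
  now rewrite assign_weave, eval_to_even, eval_to_odd, Ht, Hu.
Qed.

Lemma Delta_mem f X : Term f -> Delta (fun s => mem M (f s) X).
Proof.
  intros (t & v & Ht). exists (fmem t 0), v, (fun _ => X).
  split; [constructor|]. intros s. simpl. now rewrite Ht.
Qed.

Lemma Delta_not P : Delta P -> Delta (fun s => ~ P s).
Proof. intros H. apply Delta_imp; [exact H | apply Delta_bot]. Qed.

Lemma Delta_and P Q : Delta P -> Delta Q -> Delta (fun s => P s /\ Q s).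
Proof.
  intros HP HQ. apply Delta_ext with (fun s => ~ (P s -> ~ Q s)).
  - intros s. tauto.
  - now apply Delta_not, Delta_imp, Delta_not.
Qed.

Lemma Delta_or P Q : Delta P -> Delta Q -> Delta (fun s => P s \/ Q s).
Proof.
  intros HP HQ. apply Delta_ext with (fun s => ~ P s -> Q s).
  - intros s. tauto.
  - now apply Delta_imp; [apply Delta_not|].
Qed.

Lemma Delta_iff P Q : Delta P -> Delta Q -> Delta (fun s => P s <-> Q s).
Proof. intros HP HQ. now apply Delta_and; apply Delta_imp. Qed.

Definition unbind (v : nat -> N + nat) (n : nat) : term :=
  match v n with inr 0 => tvar 0 | _ => tvar (S n) end.
Definition tail (v : nat -> N + nat) (n : nat) : N + nat :=
  match v n with inl c => inl c | inr k => inr (pred k) end.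

Lemma sat_unbind v x s r phi :
  sat M (scons x (assign (tail v) s)) r (fsubst (unbind v) (fun X => X) phi)
  <-> sat M (assign v (scons x s)) r phi.
Proof.
  rewrite sat_fsubst.
  replace (fun n => eval M (scons x (assign (tail v) s)) (unbind v n))
    with (assign v (scons x s)); [reflexivity|].
  apply functional_extensionality. intros n. unfold unbind, tail, assign.
  destruct (v n) as [c|[|k]] eqn:E; simpl; rewrite ?E; reflexivity.
Qed.

Lemma Delta_ball f (P : N -> (nat -> N) -> Prop) :
  Term f -> Delta (fun s => P (s 0) (fun n => s (S n))) ->
  Delta (fun s => forall x, lt M x (f s) -> P x s).
Proof.
  intros (t & v & Ht) (phi & w & r & Hphi & HP).
  set (rn := scons (tvar 0) (fun n => tvar (S (S (2 * n))))).
  exists (fall (tvar 0 < tshift (tsubst to_even t)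
           ⇒ fsubst rn (fun X => X) (fsubst (unbind w) (fun X => X) phi)))%form,
    (weave v (tail w)), r.
  split; [constructor; now do 2 apply Delta00_fsubst|].
  intros s. cbn [sat eval]. split; intros H x.
  all: specialize (H x); rewrite ?eval_tshift in *.
  all: rewrite ?assign_weave, ?eval_to_even in *.
  all: rewrite sat_fsubst in *.
  all: replace (fun n => eval M (scons x (weave (assign v s) (assign (tail w) s)))
                  (rn n)) with (scons x (assign (tail w) s)) in *
    by (apply functional_extensionality; intros [|n]; [reflexivity|];
        exact (eq_sym (weave_odd _ _ n))).
  all: rewrite sat_unbind, <- HP in *; simpl scons in *.
  all: rewrite Ht in *; exact H.
Qed.

Lemma Delta_bex f (P : N -> (nat -> N) -> Prop) :
  Term f -> Delta (fun s => P (s 0) (fun n => s (S n))) ->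
  Delta (fun s => exists x, lt M x (f s) /\ P x s).
Proof.
  intros Hf HP.
  apply Delta_ext with (fun s => ~ forall x, lt M x (f s) -> ~ P x s).
  - intros s. split.
    + intros H. apply NNPP. intros H'. apply H. intros x Hx HPx. apply H'. eauto.
    + intros (x & Hx & HPx) H. exact (H x Hx HPx).
  - apply Delta_not, Delta_ball; [exact Hf|]. apply Delta_not, HP.
Qed.

(** ** The schemes of RCA0 *)

Hypothesis HM : satisfies M RCA0.

Lemma sigma_formula (Q : N -> N -> Prop) :
  Delta (fun s => Q (s 0) (s 1)) ->
  exists phi s r, Delta00 phi /\
    forall x n, Q x n <-> sat M (scons x (scons n s)) r phi.
Proof.
  intros (phi & v & r & Hphi & HQ).
  exists (fsubst (scons (tvar 0) (fun n => tshift (unbind (tail v) n)))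
            (fun X => X) (fsubst (unbind v) (fun X => X) phi)),
    (assign (tail (tail v)) (fun _ => zero M)), r.
  split; [now do 2 apply Delta00_fsubst|]. intros x n.
  rewrite sat_fsubst.
  replace (fun k => eval M _ _)
    with (scons x (assign (tail v) (scons n (fun _ => zero M)))).
  - rewrite sat_unbind. apply (HQ (scons x (scons n (fun _ => zero M)))).
  - apply functional_extensionality. intros [|k]; [reflexivity|].
    cbn [scons]. rewrite eval_tshift. unfold unbind, assign, tail.
    destruct (v k) as [c|[|[|j]]] eqn:E; simpl; rewrite ?E; reflexivity.
Qed.

Lemma sigma_induction (Q : N -> N -> Prop) :
  Delta (fun s => Q (s 0) (s 1)) ->
  (exists x, Q x (zero M)) ->
  (forall n, (exists x, Q x n) -> exists x, Q x (add M n (one M))) ->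
  forall n, exists x, Q x n.
Proof.
  intros HQ H0 HS.
  destruct (sigma_formula Q HQ) as (phi & s & r & Hphi & E).
  assert (Hex : forall n, sat M (scons n s) r (fex phi) <-> exists x, Q x n).
  { intros n. rewrite sat_ex.
    split; intros [x Hx]; exists x; apply E, Hx. }
  pose proof (HM _ (RCA0_Sigma01_induction _ (Sigma01_intro _ Hphi)) s r) as H.
  unfold induction_axiom in H. cbn [sat] in H.
  intros n. apply Hex, H, sat_and. split.
  - rewrite sat_inst_num. cbn [eval]. now apply Hex.
  - intros m Hm. apply Hex in Hm. rewrite sat_fsubst.
    replace (fun k => eval M _ _) with (scons (add M m (one M)) s).
    + apply Hex, HS, Hm.
    + apply functional_extensionality. now intros [|k].
Qed.

Lemma delta1_comprehension (Q Q' : N -> N -> Prop) :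
  Delta (fun s => Q (s 0) (s 1)) -> Delta (fun s => Q' (s 0) (s 1)) ->
  (forall n, (exists x, Q x n) <-> (forall x, Q' x n)) ->
  exists X, forall n, mem M n X <-> exists x, Q x n.
Proof.
  intros HQ HQ' H.
  destruct (sigma_formula Q HQ) as (phi & s & r & Hphi & E).
  destruct (sigma_formula Q' HQ') as (psi & s' & r' & Hpsi & E').
  set (e := scons (tvar 0) (scons (tvar 1) (fun n => tvar (S (S (2 * n)))))).
  set (o := scons (tvar 0) (scons (tvar 1) (fun n => tvar (S (S (S (2 * n))))))).
  assert (Ee : forall x n, Q x n <->
    sat M (scons x (scons n (weave s s'))) (weave r r')
      (fsubst e (fun X => 2 * X) phi)).
  { intros x n. rewrite sat_fsubst, E.
    replace (fun k => eval M _ (e k)) with (scons x (scons n s)).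
    - replace (fun X => weave r r' (2 * X)) with r; [reflexivity|].
      apply functional_extensionality. intros k. symmetry. apply weave_even.
    - apply functional_extensionality. intros [|[|k]]; try reflexivity.
      exact (eq_sym (weave_even _ _ k)). }
  assert (Eo : forall x n, Q' x n <->
    sat M (scons x (scons n (weave s s'))) (weave r r')
      (fsubst o (fun X => S (2 * X)) psi)).
  { intros x n. rewrite sat_fsubst, E'.
    replace (fun k => eval M _ (o k)) with (scons x (scons n s')).
    - replace (fun X => weave r r' (S (2 * X))) with r'; [reflexivity|].
      apply functional_extensionality. intros k. symmetry. apply weave_odd.
    - apply functional_extensionality. intros [|[|k]]; try reflexivity.
      exact (eq_sym (weave_odd _ _ k)). }
  pose proof (HM _ (RCA0_Delta01_comprehension _ _
    (Sigma01_intro _ (Delta00_fsubst phi Hphi e (fun X => 2 * X)))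
    (Pi01_intro _ (Delta00_fsubst psi Hpsi o (fun X => S (2 * X)))))
    (weave s s') (weave r r')) as C.
  unfold comprehension_axiom in C. cbn [sat] in C.
  rewrite sat_Ex in C. destruct C as [X HX].
  - intros n. apply sat_iff. rewrite sat_ex. cbn [sat].
    split.
    + intros [x Hx] y. apply Eo. revert y. apply H. exists x. now apply Ee.
    + intros Hall. destruct (proj2 (H n)) as [x Hx].
      * intros x. apply Eo, Hall.
      * exists x. now apply Ee.
  - exists X. intros n. specialize (HX n). rewrite sat_iff in HX.
    rewrite sat_shift_set, sat_ex in HX. cbn [sat eval scons] in HX.
    rewrite HX. split; intros [x Hx]; exists x; apply Ee, Hx.
Qed.

Lemma comprehension (P : N -> Prop) :
  Delta (fun s => P (s 0)) -> exists X, forall n, mem M n X <-> P n.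
Proof.
  intros HP.
  assert (HQ : Delta (fun s => (fun _ n => P n) (s 0) (s 1))).
  { destruct HP as (phi & v & r & Hphi & HP).
    exists phi, (fun n => match v n with inl c => inl c | inr k => inr (S k) end), r.
    split; auto. intros s. specialize (HP (fun n => s (S n))). simpl in HP.
    rewrite HP. replace (assign _ s) with (assign v (fun n => s (S n)));
      [reflexivity|].
    apply functional_extensionality. intros n. unfold assign.
    now destruct (v n). }
  destruct (delta1_comprehension _ _ HQ HQ) as [X HX].
  - intros n. split; [intros [_ H]; auto | intros H; exists (zero M); apply (H (zero M))].
  - exists X. intros n. rewrite HX. split; [intros [_ H]; auto | exists (zero M); auto].
Qed.

Lemma delta_induction (P : N -> Prop) :
  Delta (fun s => P (s 0)) -> P (zero M) ->
  (forall n, P n -> P (add M n (one M))) -> forall n, P n.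
Proof.
  intros HP H0 HS n. destruct (comprehension P HP) as [X HX].
  destruct (sigma_induction (fun _ n => mem M n X)) with n as [_ H].
  - apply Delta_mem, Term_var.
  - exists (zero M). now apply HX.
  - intros k [_ Hk]. exists (zero M). now apply HX, HS, HX.
  - now apply HX.
Qed.

End Definability.

Create HintDb definable.

Ltac term_step :=
  cbv beta;
  match goal with
  | |- Term _ (fun s => add _ _ _) => apply Term_add
  | |- Term _ (fun s => mul _ _ _) => apply Term_mul
  | |- Term _ (fun s => pr _ _ _) => apply Term_pr
  | |- Term _ (fun s => ?f (fun n => _)) => apply (Term_rename _ f); assumption
  | |- Term _ _ => solve [apply Term_const | apply Term_var | assumption]
  end.
Ltac term := repeat term_step.
#[export] Hint Extern 0 (Term _ _) => solve [term] : definable.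

Ltac delta_step :=
  cbv beta;
  match goal with
  | |- Term _ _ => term_step
  | |- Delta _ (fun s => forall x, lt _ x _ -> _) => apply Delta_ball
  | |- Delta _ (fun s => exists x, lt _ x _ /\ _) => apply Delta_bex; [assumption | |]
  | |- Delta _ (fun s => ~ _) => apply Delta_not; [assumption |]
  | |- Delta _ (fun s => _ <-> _) => apply Delta_iff; [assumption | |]
  | |- Delta _ (fun s => _ /\ _) => apply Delta_and; [assumption | |]
  | |- Delta _ (fun s => _ \/ _) => apply Delta_or; [assumption | |]
  | |- Delta _ (fun s => False) => apply Delta_bot; assumption
  | |- Delta _ (fun s => _ = _) => apply Delta_eq; [assumption | |]
  | |- Delta _ (fun s => lt _ _ _) => apply Delta_lt; [assumption | |]
  | |- Delta _ (fun s => mem _ _ _) => apply Delta_mem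
  | |- Delta _ (fun s => _ -> _) => apply Delta_imp
  | |- Delta _ _ => solve [auto with definable]
  end.
Ltac delta := repeat delta_step.

Declare Scope num_scope.
Delimit Scope num_scope with num.

Section Arithmetic.
Variable M : model.
Variable X0 : set M.
Hypothesis HM : satisfies M RCA0.

Local Notation N := (num M).
Local Notation "𝟎" := (zero M).
Local Notation "𝟏" := (one M).
Local Infix "+" := (add M) : num_scope.
Local Infix "*" := (mul M) : num_scope.
Local Infix "<" := (lt M) : num_scope.
Local Open Scope num_scope.

Implicit Types a b c d m n k i e s v w : N.

Lemma basic phi m n : basic_axiom phi -> sat M (scons m (fun _ => n)) (fun _ => X0) phi.
Proof. intros H. now apply HM, RCA0_basic. Qed.

Lemma add_0_r m : m + 𝟎 = m.
Proof. exact (basic _ m m ax_add0). Qed.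
Lemma add_succ_r m n : m + (n + 𝟏) = (m + n) + 𝟏.
Proof. exact (basic _ m n ax_addS). Qed.
Lemma mul_0_r m : m * 𝟎 = 𝟎.
Proof. exact (basic _ m m ax_mul0). Qed.
Lemma mul_succ_r m n : m * (n + 𝟏) = m * n + m.
Proof. exact (basic _ m n ax_mulS). Qed.
Lemma succ_neq_0 m : m + 𝟏 <> 𝟎.
Proof. exact (basic _ m m ax_succ_neq0). Qed.

Lemma nlt_0 m : ~ m < 𝟎.
Proof. exact (basic _ m m ax_lt0). Qed.
Lemma lt_succ m n : m < n + 𝟏 <-> m < n \/ m = n.
Proof. pose proof (basic _ m n ax_ltS) as H. rewrite sat_iff, sat_or in H. exact H. Qed.

Ltac induct n := revert n; refine (delta_induction M HM _ _ _ _); [delta | |]; cbv beta.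

Lemma add_0_l m : 𝟎 + m = m.
Proof. induct m; [apply add_0_r|]. intros m IH. now rewrite add_succ_r, IH. Qed.

Lemma add_succ_l m n : (m + 𝟏) + n = (m + n) + 𝟏.
Proof.
  induct n; [now rewrite !add_0_r|]. intros n IH.
  now rewrite !add_succ_r, IH.
Qed.

Lemma add_comm m n : m + n = n + m.
Proof.
  induct n; [now rewrite add_0_r, add_0_l|]. intros n IH.
  now rewrite add_succ_r, add_succ_l, IH.
Qed.

Lemma add_assoc m n k : m + (n + k) = (m + n) + k.
Proof.
  induct k; [now rewrite !add_0_r|]. intros k IH.
  now rewrite !add_succ_r, IH.
Qed.

Lemma mul_0_l m : 𝟎 * m = 𝟎.
Proof. induct m; [apply mul_0_r|]. intros m IH. now rewrite mul_succ_r, IH, add_0_r. Qed.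

Lemma mul_succ_l m n : (m + 𝟏) * n = m * n + n.
Proof.
  induct n; [now rewrite !mul_0_r, add_0_r|]. intros n IH.
  rewrite !mul_succ_r, IH, !add_succ_r. f_equal.
  rewrite <- !add_assoc. f_equal. apply add_comm.
Qed.

Lemma mul_comm m n : m * n = n * m.
Proof.
  induct n; [now rewrite mul_0_r, mul_0_l|]. intros n IH.
  now rewrite mul_succ_r, mul_succ_l, IH.
Qed.

Lemma mul_add_distr_r m n k : (m + n) * k = m * k + n * k.
Proof.
  induct k; [now rewrite !mul_0_r, add_0_r|]. intros k IH.
  rewrite !mul_succ_r, IH, <- !add_assoc. f_equal.
  rewrite !add_assoc. f_equal. apply add_comm.
Qed.

Lemma mul_assoc m n k : m * (n * k) = (m * n) * k.
Proof.
  induct k; [now rewrite !mul_0_r|]. intros k IH.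
  rewrite !mul_succ_r, <- IH, (mul_comm m (n * k + n)), mul_add_distr_r.
  now rewrite (mul_comm (n * k)), (mul_comm n m).
Qed.

Lemma mul_1_l m : 𝟏 * m = m.
Proof.
  rewrite <- (add_0_l 𝟏) at 1. now rewrite mul_succ_l, mul_0_l, add_0_l.
Qed.

Lemma num_semi_ring : semi_ring_theory 𝟎 𝟏 (add M) (mul M) eq.
Proof.
  constructor; intros.
  all: auto using add_0_l, add_comm, add_assoc, mul_1_l, mul_0_l, mul_comm,
    mul_assoc, mul_add_distr_r.
Qed.

Add Ring num_ring : num_semi_ring.

(** ** Order *)

Lemma lt_succ_diag m : m < m + 𝟏.
Proof. apply lt_succ. now right. Qed.

Lemma lt_lt_succ m n : m < n -> m < n + 𝟏.
Proof. intros H. apply lt_succ. now left. Qed.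

Lemma lt_trans x y z : x < y -> y < z -> x < z.
Proof.
  induct z.
  - intros _ H. now apply nlt_0 in H.
  - intros z IH Hxy Hyz. apply lt_lt_succ.
    apply lt_succ in Hyz as [Hyz| <-]; auto.
Qed.

Lemma lt_irrefl x : ~ x < x.
Proof.
  induct x; [apply nlt_0|].
  intros x IH H. apply IH. apply lt_succ in H as [H|H].
  - exact (lt_trans _ _ _ (lt_succ_diag x) H).
  - rewrite <- H at 2. apply lt_succ_diag.
Qed.

Lemma lt_asymm x y : x < y -> ~ y < x.
Proof. intros H H'. exact (lt_irrefl x (lt_trans _ _ _ H H')). Qed.

Lemma lt_succ_l x y : x < y -> x + 𝟏 < y + 𝟏.
Proof.
  induct y.
  - intros H. now apply nlt_0 in H.
  - intros y IH H. apply lt_succ in H as [H| <-].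
    + now apply lt_lt_succ, IH.
    + apply lt_succ_diag.
Qed.

Lemma lt_0_succ n : 𝟎 < n + 𝟏.
Proof.
  induct n.
  - apply lt_succ_diag.
  - intros n IH. now apply lt_lt_succ.
Qed.

Lemma zero_or_succ x : x = 𝟎 \/ exists y, x = y + 𝟏.
Proof.
  assert (H : x = 𝟎 \/ exists y, y < x /\ x = y + 𝟏).
  { induct x; [now left|]. intros x _. right. exists x. split; auto.
    apply lt_succ_diag. }
  destruct H as [H|(y & _ & H)]; eauto.
Qed.

Lemma lt_trichotomy x y : x < y \/ x = y \/ y < x.
Proof.
  induct x.
  - destruct (zero_or_succ y) as [->|[z ->]]; auto using lt_0_succ.
  - intros x [H|[<-|H]].
    + apply lt_succ_l in H. apply lt_succ in H. tauto.
    + right. right. apply lt_succ_diag.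
    + right. right. now apply lt_lt_succ.
Qed.

Lemma nlt_succ x y : ~ x < y -> y < x + 𝟏.
Proof.
  intros H. apply lt_succ. destruct (lt_trichotomy x y) as [H'|[H'|H']]; auto.
  contradiction.
Qed.

Lemma add_lt_mono_r x y z : x < y -> x + z < y + z.
Proof.
  induct z; [now rewrite !add_0_r|].
  intros z IH H. rewrite !add_succ_r. now apply lt_succ_l, IH.
Qed.

Lemma lt_exists x y : x < y -> exists z, y = x + z + 𝟏.
Proof.
  intros H. cut (exists z, z < y /\ y = x + z + 𝟏).
  - intros (z & _ & Hz). eauto.
  - revert H. induct y.
    + intros H. now apply nlt_0 in H.
    + intros y IH H. apply lt_succ in H as [H| <-].
      * destruct (IH H) as (z & Hz & E). exists (z + 𝟏).
        split; [now apply lt_succ_l|]. rewrite E at 1. ring.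
      * exists 𝟎. split; [apply lt_0_succ | ring].
Qed.

Lemma lt_add_succ x z : x < x + z + 𝟏.
Proof.
  replace (x + z + 𝟏) with (z + 𝟏 + x) by ring.
  rewrite <- (add_0_l x) at 1. apply add_lt_mono_r, lt_0_succ.
Qed.

Lemma lt_iff_exists x y : x < y <-> exists z, y = x + z + 𝟏.
Proof. split; [apply lt_exists | intros [z ->]; apply lt_add_succ]. Qed.

Lemma lt_add_r x z : x < x + z + 𝟏 /\ x < z + x + 𝟏.
Proof. split; [|rewrite (add_comm z)]; apply lt_add_succ. Qed.

Lemma add_cancel_r x y z : x + z = y + z -> x = y.
Proof.
  intros E. destruct (lt_trichotomy x y) as [H|[H|H]]; auto;
    apply (add_lt_mono_r _ _ z) in H; rewrite E in H; now apply lt_irrefl in H.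
Qed.

Lemma strong_induction (P : N -> Prop) :
  Delta M (fun s : nat -> N => P (s 0%nat)) ->
  (forall n, (forall k, k < n -> P k) -> P n) -> forall n, P n.
Proof.
  intros HP H n. apply H. destruct (comprehension M HM P HP) as [X HX].
  assert (E : forall k, k < n -> mem M k X).
  { induct n.
    - intros k Hk. now apply nlt_0 in Hk.
    - intros n IH k Hk. apply lt_succ in Hk as [Hk| ->]; auto.
      apply HX, H. intros j Hj. apply HX. auto. }
  intros k Hk. apply HX; auto.
Qed.

Lemma least_element (P : N -> Prop) n :
  Delta M (fun s : nat -> N => P (s 0%nat)) -> P n ->
  exists m, P m /\ forall k, k < m -> ~ P k.
Proof.
  intros HP Hn. apply NNPP. intros H. revert n Hn.
  refine (strong_induction (fun n => ~ P n) _ _); [now apply Delta_not|].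
  intros n IH Hn. apply H. eauto.
Qed.

(** ** Pairing *)

Local Notation pr := (pr M).

Lemma le_square u : u < u * u + 𝟏.
Proof.
  destruct (zero_or_succ u) as [->|[v ->]].
  - apply lt_0_succ.
  - apply lt_iff_exists. exists (v * v + v). ring.
Qed.

Lemma lt_pr_l a b : a < pr a b + 𝟏.
Proof. unfold pr. apply lt_add_r. Qed.

Lemma lt_pr_r a b : b < pr a b + 𝟏.
Proof.
  unfold pr. pose proof (le_square (a + b)) as H.
  apply lt_exists in H as [z Hz]. apply lt_iff_exists. exists (a + a + z).
  replace ((a + b) * (a + b) + a + 𝟏) with ((a + b) * (a + b) + 𝟏 + a) by ring.
  rewrite Hz. ring.
Qed.

Lemma pr_sum_lt a b a' b' : a + b < a' + b' -> pr a b < pr a' b'.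
Proof.
  intros H. apply lt_exists in H as [z Hz]. unfold pr. rewrite Hz.
  apply lt_iff_exists.
  exists ((a + b) + b + z * z + 𝟏 * (𝟏 + 𝟏) * z * (a + b) + (𝟏 + 𝟏) * z + a').
  ring.
Qed.

Lemma pr_inj a b a' b' : pr a b = pr a' b' -> a = a' /\ b = b'.
Proof.
  intros E. destruct (lt_trichotomy (a + b) (a' + b')) as [H|[H|H]].
  - apply pr_sum_lt in H. rewrite E in H. now apply lt_irrefl in H.
  - assert (a = a').
    { unfold pr in E. rewrite H in E. rewrite !(add_comm (_ * _)) in E.
      now apply add_cancel_r in E. }
    subst a'. split; auto. rewrite !(add_comm a) in H. now apply add_cancel_r in H.
  - apply pr_sum_lt in H. rewrite E in H. now apply lt_irrefl in H.
Qed.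

(** ** Coding of finite sets *)

Definition dvd a c : Prop := exists q, q < c + 𝟏 /\ a * q = c.

(* As in Gödel's beta function, [i] belongs to the finite set coded by [m] and
   [c] when the modulus [1 + (i + 1) m] divides [c]; the moduli are coprime
   when every number that occurs as a difference of indices divides [m]. *)
Definition modulus m i : N := 𝟏 + (i + 𝟏) * m.
Definition coded m c i : Prop := dvd (modulus m i) c.

Lemma modulus_dvd m i c q : modulus m i * q = c -> coded m c i.
Proof.
  intros E. exists q. split; auto. apply lt_iff_exists.
  exists ((i + 𝟏) * m * q). rewrite <- E. unfold modulus. ring.
Qed.

Lemma modulus_dvd_remainder m i x y c :
  modulus m i * x + c = modulus m i * y -> coded m c i.
Proof.
  intros E. destruct (lt_trichotomy x y) as [H|[<-|H]].
  - apply lt_iff_exists in H as [z ->]. apply (modulus_dvd m i c (z + 𝟏)).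
    apply (add_cancel_r _ _ (modulus m i * x)).
    rewrite (add_comm c), E. ring.
  - apply (modulus_dvd m i c 𝟎). apply (add_cancel_r _ _ (modulus m i * x)).
    rewrite (add_comm c), E. ring.
  - apply lt_iff_exists in H as [z ->]. destruct (lt_irrefl (modulus m i * y)).
    apply lt_iff_exists. exists (modulus m i * z + (i + 𝟏) * m + c).
    transitivity (modulus m i * (y + z + 𝟏) + c); [now symmetry|].
    unfold modulus. ring.
Qed.

(* Some combination of the moduli of [i] and [k] equals [d], hence some
   combination equals [m], which is invertible for the modulus of [i]; the
   witnesses result from clearing the negative terms. *)
Lemma modulus_coprime m i k d z c :
  k = i + d \/ i = k + d -> m = d * z ->
  coded m (c * modulus m k) i -> coded m c i.
Proof.
  intros Hd Hm (q & _ & E). destruct Hd as [Hd | Hd].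
  - apply (modulus_dvd_remainder m i ((i + 𝟏) * c * z * (k + 𝟏))
      ((i + 𝟏) * (i + 𝟏) * z * q + c)).
    transitivity ((i + 𝟏) * (i + 𝟏) * z * (modulus m i * q) + modulus m i * c);
      [rewrite E | ring].
    unfold modulus. subst m k. ring.
  - apply (modulus_dvd_remainder m i ((i + 𝟏) * (i + 𝟏) * z * q)
      (c + (i + 𝟏) * c * z * (k + 𝟏))).
    transitivity ((i + 𝟏) * (i + 𝟏) * z * (modulus m i * q) + c);
      [ring | rewrite E].
    unfold modulus. subst m i. ring.
Qed.

Lemma common_multiple n :
  exists m, 𝟎 < m /\ forall d, d < n -> exists z, z < m + 𝟏 /\ m = (d + 𝟏) * z.
Proof.
  revert n.
  refine (sigma_induction M HM (fun m n => 𝟎 < m /\ forall d, d < n ->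
    exists z, z < m + 𝟏 /\ m = (d + 𝟏) * z) _ _ _); [delta| |].
  - exists 𝟏. split.
    + rewrite <- (add_0_l 𝟏). apply lt_0_succ.
    + intros d Hd. now apply nlt_0 in Hd.
  - intros n (m & Hm & H). exists (m * (n + 𝟏)).
    apply lt_iff_exists in Hm as [p Hp]. split.
    + apply lt_iff_exists. exists (p * (n + 𝟏) + n). rewrite Hp. ring.
    + assert (B : forall d z, m * (n + 𝟏) = (d + 𝟏) * z -> z < m * (n + 𝟏) + 𝟏).
      { intros d z E. rewrite E. apply lt_iff_exists. exists (d * z). ring. }
      intros d Hd. apply lt_succ in Hd as [Hd| ->].
      * destruct (H d Hd) as (z & _ & E).
        assert (E' : m * (n + 𝟏) = (d + 𝟏) * (z * (n + 𝟏))) by (rewrite E at 1; ring).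
        exists (z * (n + 𝟏)). eauto.
      * assert (E' : m * (n + 𝟏) = (n + 𝟏) * m) by ring. exists m. eauto.
Qed.

Lemma code_segment X n : exists m c, forall i, i < n -> (coded m c i <-> mem M i X).
Proof.
  destruct (common_multiple n) as (m & Hm & Hdiv). exists m.
  cut (forall k, exists c, 𝟎 < c /\
    forall i, i < n -> (coded m c i <-> i < k /\ mem M i X)).
  { intros H. destruct (H n) as (c & _ & Hc). exists c. intros i Hi.
    rewrite Hc by exact Hi. tauto. }
  refine (sigma_induction M HM (fun c k => 𝟎 < c /\
    forall i, i < n -> (coded m c i <-> i < k /\ mem M i X)) _ _ _).
  - unfold coded, dvd, modulus. delta.
  - exists 𝟏. split.
    + rewrite <- (add_0_l 𝟏). apply lt_0_succ.
    + intros i _. split; [|intros [H _]; now apply nlt_0 in H].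
      intros (q & _ & E). exfalso. apply (lt_irrefl 𝟏). rewrite <- E at 2.
      apply lt_iff_exists in Hm as [p ->]. unfold modulus in *.
      destruct (zero_or_succ q) as [->|[y ->]].
      * destruct (succ_neq_0 𝟎). rewrite <- E at 1. ring.
      * apply lt_iff_exists.
        exists ((i + 𝟏) * (p + 𝟏) * y + i * (p + 𝟏) + p + y). ring.
  - intros k (c & Hc & H).
    destruct (classic (k < n /\ mem M k X)) as [[Hk HX]|Hk].
    + exists (c * modulus m k). split.
      { apply lt_iff_exists in Hc as [p ->]. apply lt_iff_exists.
        unfold modulus. exists (p + (𝟎 + p + 𝟏) * (k + 𝟏) * m). ring. }
      intros i Hi. destruct (classic (i = k)) as [->|Hik].
      { split; [auto using lt_succ_diag|]. intros _.
        apply modulus_dvd with c. ring. }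
      transitivity (coded m c i).
      * split.
        -- assert (Hd : exists d, d < n /\ (k = i + (d + 𝟏) \/ i = k + (d + 𝟏))).
           { destruct (lt_trichotomy i k) as [L|[L|L]]; [|contradiction|];
               apply lt_iff_exists in L as [d L]; exists d.
             - split; [|left; rewrite L; ring].
               apply lt_trans with k; auto. rewrite L. apply lt_iff_exists.
               exists i. ring.
             - split; [|right; rewrite L; ring].
               apply lt_trans with i; auto. rewrite L. apply lt_iff_exists.
               exists k. ring. }
           destruct Hd as (d & Hd & E). destruct (Hdiv d Hd) as (z & _ & Hz).
           exact (modulus_coprime m i k (d + 𝟏) z c E Hz).
        -- intros (q & _ & E). apply modulus_dvd with (q * modulus m k).
           rewrite <- E. ring.
      * rewrite H by exact Hi. rewrite lt_succ. tauto.
    + exists c. split; [exact Hc|]. intros i Hi. rewrite H by exact Hi.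
      rewrite lt_succ. split; [tauto|]. intros [[Hik| ->] HX]; tauto.
Qed.

(** ** Cuts of a family of preorders *)

Section Cuts.

Variable D : N -> Prop.
Variable T : N -> N -> N -> Prop.
Hypothesis D_definable : forall f, Term M f -> Delta M (fun s : nat -> N => D (f s)).
Hypothesis T_definable : forall f g h, Term M f -> Term M g -> Term M h ->
  Delta M (fun s : nat -> N => T (f s) (g s) (h s)).

#[local] Hint Resolve D_definable T_definable : definable.

Definition cut_step s e v (A : N -> Prop) : Prop :=
  D v /\ (v < s /\ T v e s \/
          ~ v < s /\ exists w, w < v /\ (A w /\ T v w (v + 𝟏))).

Definition cut_code s e n m c : Prop :=
  forall v, v < n -> (coded m c v <-> cut_step s e v (coded m c)).

Lemma cut_step_ext s e v (A B : N -> Prop) :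
  (forall w, w < v -> (A w <-> B w)) -> cut_step s e v A <-> cut_step s e v B.
Proof.
  intros H. unfold cut_step.
  enough ((exists w, w < v /\ (A w /\ T v w (v + 𝟏)))
      <-> (exists w, w < v /\ (B w /\ T v w (v + 𝟏)))) by tauto.
  split; intros (w & Hw & HA & HT); exists w; repeat split; auto; now apply H.
Qed.

Lemma Delta_coded f g h : Term M f -> Term M g -> Term M h ->
  Delta M (fun s : nat -> N => coded (f s) (g s) (h s)).
Proof. intros. unfold coded, dvd, modulus. delta. Qed.
#[local] Hint Resolve Delta_coded : definable.

Lemma Delta_cut_code f1 f2 f3 f4 f5 :
  Term M f1 -> Term M f2 -> Term M f3 -> Term M f4 -> Term M f5 ->
  Delta M (fun s : nat -> N => cut_code (f1 s) (f2 s) (f3 s) (f4 s) (f5 s)).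
Proof. intros. unfold cut_code, cut_step. delta. Qed.
#[local] Hint Resolve Delta_cut_code : definable.

Lemma cut_code_exists s e n : exists m c, cut_code s e n m c.
Proof.
  cut (exists z m, m < z /\ exists c, c < z /\ cut_code s e n m c).
  { intros (_ & m & _ & c & _ & H). eauto. }
  revert n.
  refine (sigma_induction M HM (fun z n =>
    exists m, m < z /\ exists c, c < z /\ cut_code s e n m c) _ _ _).
  - delta.
  - exists (𝟎 + 𝟏), 𝟎. split; [apply lt_0_succ|]. exists 𝟎.
    split; [apply lt_0_succ|]. intros v Hv. now apply nlt_0 in Hv.
  - intros n (_ & m & _ & c & _ & H).
    destruct (comprehension M HM
      (fun v => v < n /\ coded m c v \/ v = n /\ cut_step s e v (coded m c)))
      as [X HX]; [unfold cut_step; delta|].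
    destruct (code_segment X (n + 𝟏)) as (m' & c' & H').
    assert (Hlt : forall v, v < n -> (coded m' c' v <-> coded m c v)).
    { intros v Hv. rewrite H' by now apply lt_lt_succ. rewrite HX.
      assert (v <> n) by (intros ->; now apply lt_irrefl in Hv). tauto. }
    exists (m' + c' + 𝟏), m'. split; [apply (lt_add_r)|].
    exists c'. split; [apply (lt_add_r)|].
    intros v Hv. rewrite (cut_step_ext s e v _ (coded m c)).
    + rewrite H', HX by exact Hv. apply lt_succ in Hv as [Hv| ->].
      * assert (v <> n) by (intros ->; now apply lt_irrefl in Hv).
        rewrite <- (H v Hv). tauto.
      * assert (~ n < n) by apply lt_irrefl. tauto.
    + intros w Hw. apply Hlt. apply lt_succ in Hv as [Hv| ->]; eauto using lt_trans.
Qed.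

Lemma cut_code_unique s e n n' m c m' c' :
  cut_code s e n m c -> cut_code s e n' m' c' ->
  forall v, v < n -> v < n' -> (coded m c v <-> coded m' c' v).
Proof.
  intros H H'.
  refine (strong_induction (fun v => v < n -> v < n' ->
    (coded m c v <-> coded m' c' v)) _ _); [delta|].
  intros v IH Hv Hv'. rewrite (H v Hv), (H' v Hv'). apply cut_step_ext.
  intros w Hw. apply IH; eauto using lt_trans.
Qed.

Definition in_cut s e v : Prop :=
  exists m c, cut_code s e (v + 𝟏) m c /\ coded m c v.

Lemma in_cut_coded s e n m c v :
  cut_code s e n m c -> v < n -> (in_cut s e v <-> coded m c v).
Proof.
  intros H Hv. split.
  - intros (m' & c' & H' & Hc'). revert Hc'.
    apply (cut_code_unique s e _ _ _ _ _ _ H' H); auto. apply lt_succ_diag.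
  - intros Hc. exists m, c. split; [|exact Hc]. intros w Hw. apply H.
    apply lt_succ in Hw as [Hw| ->]; eauto using lt_trans.
Qed.

Lemma in_cut_step s e v : in_cut s e v <-> cut_step s e v (in_cut s e).
Proof.
  destruct (cut_code_exists s e (v + 𝟏)) as (m & c & H).
  rewrite (in_cut_coded _ _ _ _ _ _ H) by apply lt_succ_diag.
  rewrite (H v) by apply lt_succ_diag. apply cut_step_ext.
  intros w Hw. symmetry. apply (in_cut_coded _ _ _ _ _ _ H).
  now apply lt_lt_succ.
Qed.

Lemma in_cut_definable : exists X, forall s e v,
  mem M (pr (pr s e) v) X <-> in_cut s e v.
Proof.
  destruct (delta1_comprehension M HM
    (fun z x => exists s, s < x + 𝟏 /\ exists e, e < x + 𝟏 /\
       exists v, v < x + 𝟏 /\ (x = pr (pr s e) v /\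
       exists m, m < z /\ exists c, c < z /\
         (cut_code s e (v + 𝟏) m c /\ coded m c v)))
    (fun z x => exists s, s < x + 𝟏 /\ exists e, e < x + 𝟏 /\
       exists v, v < x + 𝟏 /\ (x = pr (pr s e) v /\
       forall m, m < z -> forall c, c < z ->
         cut_code s e (v + 𝟏) m c -> coded m c v))) as [X HX].
  - delta.
  - delta.
  - intros x. split.
    + intros (_ & s & Hs & e & He & v & Hv & Hx & m & _ & c & _ & H & Hc) z.
      exists s. split; auto. exists e. split; auto. exists v. do 2 (split; auto).
      intros m' _ c' _ H'. revert Hc.
      apply (cut_code_unique s e _ _ _ _ _ _ H H'); apply lt_succ_diag.
    + intros H. destruct (H 𝟎) as (s & Hs & e & He & v & Hv & Hx & _).
      destruct (cut_code_exists s e (v + 𝟏)) as (m & c & Hc).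
      destruct (H (m + c + 𝟏)) as (s' & _ & e' & _ & v' & _ & Hx' & H').
      rewrite Hx in Hx'. apply (pr_inj) in Hx' as [Hx' ->].
      apply (pr_inj) in Hx' as [-> ->].
      exists (m + c + 𝟏), s'. split; auto. exists e'. split; auto.
      exists v'. do 2 (split; auto). exists m.
      split; [apply (lt_add_r)|]. exists c.
      split; [apply (lt_add_r)|]. split; [exact Hc|].
      apply H'; auto; apply (lt_add_r).
  - exists X. intros s e v. rewrite HX. split.
    + intros (_ & s' & _ & e' & _ & v' & _ & Hx & m & _ & c & _ & H).
      apply (pr_inj) in Hx as [Hx ->].
      apply (pr_inj) in Hx as [-> ->]. now exists m, c.
    + intros (m & c & H). exists (m + c + 𝟏), s.
      assert (B : pr s e < pr (pr s e) v + 𝟏) by apply (lt_pr_l).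
      assert (L : forall u, u < pr s e + 𝟏 -> u < pr (pr s e) v + 𝟏).
      { intros u Hu. apply lt_succ in Hu as [Hu| ->]; eauto using lt_trans. }
      split; [apply L, (lt_pr_l)|]. exists e.
      split; [apply L, (lt_pr_r)|]. exists v.
      split; [apply (lt_pr_r)|]. split; auto. exists m.
      split; [apply (lt_add_r)|]. exists c.
      split; [apply (lt_add_r) | exact H].
Qed.

Lemma Delta_in_cut f g h : Term M f -> Term M g -> Term M h ->
  Delta M (fun s : nat -> N => in_cut (f s) (g s) (h s)).
Proof.
  intros Hf Hg Hh. destruct in_cut_definable as [X HX].
  apply Delta_ext with (fun s : nat -> N => mem M (pr (pr (f s) (g s)) (h s)) X).
  - intros s. apply HX.
  - delta.
Qed.
#[local] Hint Resolve Delta_in_cut : definable.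

Hypothesis T_refl : forall p s, T p p s.
Hypothesis T_trans : forall p q r s, T p q s -> T q r s -> T p r s.
Hypothesis T_total : forall p q s, D p -> D q -> T p q s \/ T q p s.
Hypothesis T_antitone : forall p q s t, s < t -> T p q t -> T p q s.

Lemma in_cut_D s e v : in_cut s e v -> D v.
Proof. intros H. apply in_cut_step in H. apply H. Qed.

Lemma in_cut_seed s e v : D v -> v < s -> (in_cut s e v <-> T v e s).
Proof. intros HD Hv. rewrite in_cut_step. unfold cut_step. tauto. Qed.

Lemma in_cut_late s e v : ~ v < s -> in_cut s e v ->
  exists w, w < v /\ in_cut s e w /\ T v w (v + 𝟏).
Proof. intros Hv H. apply in_cut_step in H. unfold cut_step in H. tauto. Qed.

Lemma in_cut_join s e v w : D v -> ~ v < s -> w < v -> in_cut s e w ->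
  T v w (v + 𝟏) -> in_cut s e v.
Proof.
  intros HD Hv Hw HA HT. apply in_cut_step. split; auto. right. split; eauto.
Qed.

Lemma T_le p q s t : s < t + 𝟏 -> T p q t -> T p q s.
Proof. intros H. apply lt_succ in H as [H| ->]; eauto. Qed.

Lemma cut_separates s e t w v : in_cut s e w -> D v -> ~ in_cut s e v ->
  s < t + 𝟏 -> w < t -> v < t -> ~ T v w t.
Proof.
  intros Hw HD Hv Hs Hwt Hvt HT.
  assert (Early : forall w, in_cut s e w -> w < s -> v < s -> ~ T v w s).
  { intros w' Hw' Hws Hvs HT'. apply Hv. apply in_cut_seed; auto.
    apply T_trans with w'; auto. apply in_cut_seed; auto.
    exact (in_cut_D _ _ _ Hw'). }
  assert (Late : forall w, in_cut s e w -> w < v -> ~ v < s -> ~ T v w (v + 𝟏)).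
  { intros w' Hw' Hwv Hvs HT'. exact (Hv (in_cut_join _ _ _ _ HD Hvs Hwv Hw' HT')). }
  assert (Step : forall w, in_cut s e w -> v < w -> ~ T v w (w + 𝟏) \/ w < s).
  { refine (strong_induction (fun w => in_cut s e w -> v < w ->
      ~ T v w (w + 𝟏) \/ w < s) _ _); [delta|].
    intros u IH Hu Hvu. destruct (classic (u < s)) as [|Hus]; [now right|].
    left. intros HT'. destruct (in_cut_late _ _ _ Hus Hu) as (u' & Hlt & Hu' & HTu).
    assert (HT2 : T v u' (u + 𝟏)) by (eapply T_trans; eauto).
    assert (Hsu : s < u + 𝟏) by now apply nlt_succ.
    assert (HTs : T v u' s) by (apply T_le with (u + 𝟏); auto using lt_lt_succ).
    destruct (lt_trichotomy u' v) as [L|[->|L]]; [|contradiction|].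
    - destruct (classic (v < s)) as [Hvs|Hvs].
      + apply (Early u'); eauto using lt_trans.
      + apply (Late u'); auto. apply T_antitone with (u + 𝟏); auto.
        now apply (add_lt_mono_r).
    - destruct (IH u' Hlt Hu' L) as [HN|Hus'].
      + apply HN. apply T_antitone with (u + 𝟏); auto.
        now apply (add_lt_mono_r).
      + apply (Early u'); eauto using lt_trans. }
  assert (Hle : forall x, x < t -> x + 𝟏 < t + 𝟏)
    by (intros x Hx; now apply (add_lt_mono_r)).
  destruct (lt_trichotomy w v) as [L|[->|L]]; [|contradiction|].
  - destruct (classic (v < s)) as [Hvs|Hvs].
    + apply (Early w); eauto using lt_trans, T_le.
    + apply (Late w); auto. apply T_le with t; auto.
  - destruct (Step w Hw L) as [HN|Hws].
    + apply HN. apply T_le with t; auto.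
    + apply (Early w); eauto using lt_trans, T_le.
Qed.

Lemma cut_strict s e w v u : in_cut s e w -> D v -> ~ in_cut s e v ->
  T w v u /\ exists t, ~ T v w t.
Proof.
  intros Hw Hv Hnv. set (t := s + u + w + v + 𝟏).
  assert (B : s < t + 𝟏 /\ u < t /\ w < t /\ v < t).
  { unfold t. repeat split; apply lt_iff_exists.
    - exists (u + w + v + 𝟏). ring.
    - exists (s + w + v). ring.
    - exists (s + u + v). ring.
    - exists (s + u + w). ring. }
  destruct B as (Bs & Bu & Bw & Bv).
  pose proof (cut_separates s e t w v Hw Hv Hnv Bs Bw Bv) as HN.
  split; [|now exists t]. apply T_antitone with t; [exact Bu|].
  destruct (T_total w v t); auto; [|contradiction]. now apply in_cut_D in Hw.
Qed.

Lemma cut_total s e s' e' :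
  (forall v, in_cut s e v -> in_cut s' e' v)
  \/ (forall v, in_cut s' e' v -> in_cut s e v).
Proof.
  apply NNPP. intros H. apply not_or_and in H as [H H'].
  apply not_all_ex_not in H as [w H]. apply imply_to_and in H as [Hw Hw'].
  apply not_all_ex_not in H' as [v H']. apply imply_to_and in H' as [Hv Hv'].
  pose proof (in_cut_D _ _ _ Hw) as Dw. pose proof (in_cut_D _ _ _ Hv) as Dv.
  set (t := s + s' + w + v + 𝟏).
  assert (B : s < t + 𝟏 /\ s' < t + 𝟏 /\ w < t /\ v < t).
  { unfold t. repeat split; apply lt_iff_exists.
    - exists (s' + w + v + 𝟏). ring.
    - exists (s + w + v + 𝟏). ring.
    - exists (s + s' + v). ring.
    - exists (s + s' + w). ring. }
  destruct B as (Bs & Bs' & Bw & Bv).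
  destruct (T_total v w t Dv Dw) as [C|C]; revert C.
  - now apply (cut_separates s e).
  - now apply (cut_separates s' e').
Qed.

Lemma cut_incl_bounded s e s' e' :
  (forall v, v < s + s' -> in_cut s e v -> in_cut s' e' v) ->
  forall v, in_cut s e v -> in_cut s' e' v.
Proof.
  intros H.
  refine (strong_induction (fun v => in_cut s e v -> in_cut s' e' v) _ _); [delta|].
  intros v IH Hv. destruct (classic (v < s + s')) as [L|L]; [now apply H|].
  assert (B : forall u, u < s \/ u < s' -> u < s + s').
  { intros u [Hu|Hu]; apply lt_iff_exists in Hu as [z ->]; apply lt_iff_exists.
    - exists (z + s'). ring.
    - exists (s + z). ring. }
  destruct (in_cut_late s e v) as (w & Hwv & Hw & HT); auto.
  apply in_cut_join with w; auto. now apply in_cut_D in Hv.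
Qed.

End Cuts.

(** ** The representation *)

Section Order.
Variable D : N -> Prop.
Variable prec : N -> N -> Prop.
Local Infix "≺" := prec (at level 70).

Hypothesis D_definable : forall f, Term M f -> Delta M (fun s : nat -> N => D (f s)).
Hypothesis prec_definable : forall f g, Term M f -> Term M g ->
  Delta M (fun s : nat -> N => f s ≺ g s).
#[local] Hint Resolve D_definable prec_definable : definable.

Hypothesis prec_D : forall p q, p ≺ q -> D p /\ D q.
Hypothesis prec_irrefl : forall p, ~ p ≺ p.
Hypothesis no_2plus2 : forall p0 q0 p1 q1, p0 ≺ q0 -> p1 ≺ q1 -> p0 ≺ q1 \/ p1 ≺ q0.
Hypothesis no_3plus1 : forall p0 p1 p2 q,
  p0 ≺ p1 -> p1 ≺ p2 -> D q -> p0 ≺ q \/ q ≺ p2.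

(* The trace preorder of a semiorder, as far as it is witnessed below [s]. *)
Definition trace p q s : Prop :=
  forall o, o < s -> (o ≺ p -> o ≺ q) /\ (q ≺ o -> p ≺ o).

Lemma trace_refl p s : trace p p s.
Proof. intros o _. tauto. Qed.

Lemma trace_trans p q r s : trace p q s -> trace q r s -> trace p r s.
Proof.
  intros H H' o Ho. specialize (H o Ho). specialize (H' o Ho). tauto.
Qed.

Lemma trace_antitone p q s t : s < t -> trace p q t -> trace p q s.
Proof. intros Hs H o Ho. apply H. eauto using lt_trans. Qed.

Lemma trace_total p q s : D p -> D q -> trace p q s \/ trace q p s.
Proof.
  intros Hp Hq. apply NNPP. intros H. apply not_or_and in H as [H H'].
  apply not_all_ex_not in H as [o H]. apply imply_to_and in H as [_ H].
  apply not_all_ex_not in H' as [u H']. apply imply_to_and in H' as [_ H'].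
  assert (Ho : o ≺ p /\ ~ o ≺ q \/ q ≺ o /\ ~ p ≺ o) by tauto.
  assert (Hu : u ≺ q /\ ~ u ≺ p \/ p ≺ u /\ ~ q ≺ u) by tauto.
  destruct Ho as [[Ho Ho']|[Ho Ho']], Hu as [[Hu Hu']|[Hu Hu']].
  - destruct (no_2plus2 o p u q); auto.
  - destruct (no_3plus1 o p u q); auto.
  - destruct (no_3plus1 u q o p); auto.
  - destruct (no_2plus2 q o p u); auto.
Qed.

Lemma Delta_trace f g h : Term M f -> Term M g -> Term M h ->
  Delta M (fun s : nat -> N => trace (f s) (g s) (h s)).
Proof. intros. unfold trace. delta. Qed.
#[local] Hint Resolve Delta_trace : definable.

Definition lower : N -> N -> N -> Prop := in_cut D trace.
Definition upper : N -> N -> N -> Prop := in_cut D (fun p q => trace q p).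

Lemma Delta_lower f g h : Term M f -> Term M g -> Term M h ->
  Delta M (fun s : nat -> N => lower (f s) (g s) (h s)).
Proof. intros. apply Delta_in_cut; auto with definable. Qed.

Lemma Delta_upper f g h : Term M f -> Term M g -> Term M h ->
  Delta M (fun s : nat -> N => upper (f s) (g s) (h s)).
Proof. intros. apply Delta_in_cut; auto with definable. Qed.
#[local] Hint Resolve Delta_lower Delta_upper : definable.

Lemma lower_D s e v : lower s e v -> D v.
Proof. apply in_cut_D; auto with definable. Qed.

Lemma upper_D s e v : upper s e v -> D v.
Proof. apply in_cut_D; auto with definable. Qed.

Lemma lower_seed s e v : D v -> v < s -> (lower s e v <-> trace v e s).
Proof. apply in_cut_seed; auto with definable. Qed.

Lemma upper_seed s e v : D v -> v < s -> (upper s e v <-> trace e v s).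
Proof. apply (in_cut_seed D (fun p q => trace q p)); auto with definable. Qed.

Lemma lower_late s e v : ~ v < s -> lower s e v ->
  exists w, w < v /\ lower s e w /\ trace v w (v + 𝟏).
Proof. apply in_cut_late; auto with definable. Qed.

Lemma upper_late s e v : ~ v < s -> upper s e v ->
  exists w, w < v /\ upper s e w /\ trace w v (v + 𝟏).
Proof. apply (in_cut_late D (fun p q => trace q p)); auto with definable. Qed.

Lemma lower_seed_max s e p v : p < s -> lower s e v -> p ≺ v -> p ≺ e.
Proof.
  intros Hp.
  refine (strong_induction (fun v => lower s e v -> p ≺ v -> p ≺ e) _ _ v); [delta|].
  clear v. intros v IH Hv Hpv. destruct (classic (v < s)) as [L|L].
  - apply lower_seed in Hv; [|now apply prec_D in Hpv|exact L].
    now apply (Hv p Hp).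
  - apply lower_late in Hv as (w & Hw & Hlow & HT); [|exact L].
    apply (IH w Hw Hlow). apply (HT p); [|exact Hpv].
    apply lt_succ. destruct (lt_trichotomy p v) as [B|[B|B]]; auto.
    destruct L. eauto using lt_trans.
Qed.

Lemma upper_seed_min s e p v : p < s -> upper s e v -> v ≺ p -> e ≺ p.
Proof.
  intros Hp.
  refine (strong_induction (fun v => upper s e v -> v ≺ p -> e ≺ p) _ _ v); [delta|].
  clear v. intros v IH Hv Hpv. destruct (classic (v < s)) as [L|L].
  - apply upper_seed in Hv; [|now apply prec_D in Hpv|exact L].
    now apply (Hv p Hp).
  - apply upper_late in Hv as (w & Hw & Hlow & HT); [|exact L].
    apply (IH w Hw Hlow). apply (HT p); [|exact Hpv].
    apply lt_succ. destruct (lt_trichotomy p v) as [B|[B|B]]; auto.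
    destruct L. eauto using lt_trans.
Qed.

Lemma lower_above_bounded s e p v : lower s e v -> p ≺ v ->
  exists u, lower s e u /\ p ≺ u /\ (u < s \/ u < p).
Proof.
  intros Hv Hpv.
  destruct (least_element (fun v => lower s e v /\ p ≺ v) v) as (u & [Hu Hpu] & Hmin);
    [delta|auto|].
  exists u. do 2 (split; auto). apply NNPP. intros H. apply not_or_and in H as [H H'].
  apply lower_late in Hu as (w & Hw & Hlow & HT); [|exact H].
  apply (Hmin w Hw). split; [exact Hlow|]. apply (HT p); [|exact Hpu].
  now apply nlt_succ.
Qed.

Lemma upper_below_bounded s e p v : upper s e v -> v ≺ p ->
  exists u, upper s e u /\ u ≺ p /\ (u < s \/ u < p).
Proof.
  intros Hv Hpv.
  destruct (least_element (fun v => upper s e v /\ v ≺ p) v) as (u & [Hu Hpu] & Hmin);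
    [delta|auto|].
  exists u. do 2 (split; auto). apply NNPP. intros H. apply not_or_and in H as [H H'].
  apply upper_late in Hu as (w & Hw & Hlow & HT); [|exact H].
  apply (Hmin w Hw). split; [exact Hlow|]. apply (HT p); [|exact Hpu].
  now apply nlt_succ.
Qed.

Lemma crossing_bounded s e s' e' w v : lower s e v -> upper s' e' w -> w ≺ v ->
  exists v, v < s + s' /\ exists w, w < s + s' /\
    (lower s e v /\ (upper s' e' w /\ w ≺ v)).
Proof.
  intros Hv Hw Hwv.
  assert (Ev : exists v, v < s + w + 𝟏 /\ (lower s e v /\ w ≺ v)).
  { destruct (lower_above_bounded s e w v) as (u & Hu & Hwu & L); auto.
    exists u. split; auto. destruct L as [L|L]; apply lt_iff_exists in L as [z ->];
      apply lt_iff_exists; [exists (z + w + 𝟏) | exists (s + z + 𝟏)]; ring. }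
  clear v Hv Hwv.
  destruct (least_element (fun w => upper s' e' w /\
    exists v, v < s + w + 𝟏 /\ (lower s e v /\ w ≺ v)) w)
    as (x & [Hx (v & _ & Hv & Hxv)] & Hmin); [delta|auto|].
  destruct (lower_above_bounded s e x v) as (u & Hu & Hxu & L); auto.
  clear v Hv Hxv.
  assert (Hbound : u < s + s' /\ x < s + s').
  { assert (Bs : forall y, y < s -> y < s + s').
    { intros y Hy. apply lt_iff_exists in Hy as [z ->]. apply lt_iff_exists.
      exists (z + s'). ring. }
    assert (Bs' : forall y, y < s' -> y < s + s').
    { intros y Hy. apply lt_iff_exists in Hy as [z ->]. apply lt_iff_exists.
      exists (s + z). ring. }
    destruct (classic (x < s')) as [Hs|Hs].
    { split; auto. destruct L as [L|L]; eauto using lt_trans. }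
    destruct (lt_trichotomy x u) as [Lx|[<-|Lx]].
    - destruct L as [L|L]; [|now apply lt_asymm in L].
      split; eauto using lt_trans.
    - now apply prec_irrefl in Hxu.
    - exfalso. apply upper_late in Hx as (y & Hy & Hup & HT); [|exact Hs].
      assert (Hyu : y ≺ u) by (apply (HT u); auto using lt_lt_succ).
      apply (Hmin y Hy). split; [exact Hup|].
      destruct (lower_above_bounded s e y u) as (z & Hz & Hyz & Lz); auto.
      exists z. split; auto. destruct Lz as [Lz|Lz]; apply lt_iff_exists in Lz as [k ->];
        apply lt_iff_exists; [exists (k + y + 𝟏) | exists (s + k + 𝟏)]; ring. }
  destruct Hbound. exists u. split; auto. exists x. auto.
Qed.

Lemma lower_strict s e w v u : lower s e w -> D v -> ~ lower s e v ->
  trace w v u /\ exists t, ~ trace v w t.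
Proof.
  apply cut_strict; eauto using trace_refl, trace_trans, trace_total,
    trace_antitone with definable.
Qed.

Lemma upper_strict s e w v u : upper s e w -> D v -> ~ upper s e v ->
  trace v w u /\ exists t, ~ trace w v t.
Proof.
  apply (cut_strict D (fun p q => trace q p)); eauto using trace_refl,
    trace_trans, trace_antitone with definable.
  intros p q r Hp Hq. apply trace_total; auto.
Qed.

Lemma lower_total s e s' e' :
  (forall v, lower s e v -> lower s' e' v) \/ (forall v, lower s' e' v -> lower s e v).
Proof.
  apply cut_total; eauto using trace_refl, trace_trans, trace_total,
    trace_antitone with definable.
Qed.

Lemma upper_total s e s' e' :
  (forall v, upper s e v -> upper s' e' v) \/ (forall v, upper s' e' v -> upper s e v).
Proof.
  apply (cut_total D (fun p q => trace q p)); eauto using trace_refl,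
    trace_trans, trace_antitone with definable.
  intros p q r Hp Hq. apply trace_total; auto.
Qed.

Lemma lower_incl_bounded s e s' e' :
  (forall v, v < s + s' -> lower s e v -> lower s' e' v) ->
  forall v, lower s e v -> lower s' e' v.
Proof. apply cut_incl_bounded; auto with definable. Qed.

Lemma upper_incl_bounded s e s' e' :
  (forall v, v < s + s' -> upper s e v -> upper s' e' v) ->
  forall v, upper s e v -> upper s' e' v.
Proof.
  apply (cut_incl_bounded D (fun p q => trace q p)); auto with definable.
Qed.

Inductive point : Type :=
| Left (s e : N)
| Right (s e : N).

(* The elements whose interval begins at or before the point [x]. *)
Definition begun (x : point) v : Prop :=
  match x with
  | Left s e => lower s e v
  | Right s e => D v /\ forall w, upper s e w -> ~ w ≺ v
  end.

(* The elements whose interval ends before the point [x]. *)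
Definition ended (x : point) v : Prop :=
  match x with
  | Left s e => exists w, lower s e w /\ v ≺ w
  | Right s e => D v /\ ~ upper s e v
  end.

Definition interval p (x : point) : Prop := begun x p /\ ~ ended x p.

Definition point_le (x y : point) : Prop :=
  match x, y with
  | Left s e, Left s' e' => forall v, lower s e v -> lower s' e' v
  | Right s e, Right s' e' => forall v, upper s' e' v -> upper s e v
  | Left s e, Right s' e' => forall v w, lower s e v -> upper s' e' w -> ~ w ≺ v
  | Right s e, Left s' e' => exists v w, lower s' e' v /\ upper s e w /\ w ≺ v
  end.

Lemma begun_mono (x y : point) v : point_le x y -> begun x v -> begun y v.
Proof.
  destruct x as [s e|s e], y as [s' e'|s' e']; simpl; intros H.
  - apply H.
  - intros Hv. split; [now apply lower_D in Hv|]. intros w Hw. now apply H.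
  - intros [Dv Hv]. destruct H as (u & w & Hu & Hw & Hwu). apply NNPP. intros Hn.
    destruct (lower_strict _ _ _ _ (w + 𝟏) Hu Dv Hn) as [HT _].
    apply (Hv w Hw). apply (HT w); [apply lt_succ_diag | exact Hwu].
  - intros [Dv Hv]. split; auto.
Qed.

Lemma ended_mono (x y : point) v : point_le x y -> ended x v -> ended y v.
Proof.
  destruct x as [s e|s e], y as [s' e'|s' e']; simpl; intros H.
  - intros (w & Hw & Hvw). eauto.
  - intros (w & Hw & Hvw). split; [now apply prec_D in Hvw|].
    intros Hu. exact (H w v Hw Hu Hvw).
  - intros [Dv Hv]. destruct H as (u & w & Hu & Hw & Hwu).
    destruct (upper_strict _ _ _ _ (u + 𝟏) Hw Dv Hv) as [HT _].
    exists u. split; [exact Hu|]. apply (HT u); [apply lt_succ_diag | exact Hwu].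
  - intros [Dv Hv]. split; auto.
Qed.

Lemma point_le_trans (x y z : point) : point_le x y -> point_le y z -> point_le x z.
Proof.
  destruct x as [s e|s e], y as [s' e'|s' e'], z as [s'' e''|s'' e'']; simpl;
    intros H H'.
  - auto.
  - intros v w Hv Hw. exact (H' v w (H v Hv) Hw).
  - destruct H' as (v & w & Hv & Hw & Hwv).
    destruct (lower_total s e s'' e'') as [I|I]; [exact I|].
    destruct (H v w); auto.
  - intros v w Hv Hw. exact (H v w Hv (H' w Hw)).
  - destruct H as (v & w & Hv & Hw & Hwv). exists v, w. auto.
  - destruct H as (v & w & Hv & Hw & Hwv).
    destruct (upper_total s'' e'' s e) as [I|I]; [exact I|].
    destruct (H' v w); auto.
  - destruct H' as (v & w & Hv & Hw & Hwv). exists v, w. auto.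
  - auto.
Qed.

Lemma point_le_total (x y : point) : point_le x y \/ point_le y x.
Proof.
  assert (HLR : forall s e s' e', point_le (Left s e) (Right s' e')
                        \/ point_le (Right s' e') (Left s e)).
  { intros s e s' e'. apply NNPP. intros H. apply not_or_and in H as [H H'].
    apply H. intros v w Hv Hw Hwv. apply H'. now exists v, w. }
  destruct x as [s e|s e], y as [s' e'|s' e']; auto.
  - apply lower_total.
  - destruct (HLR s' e' s e); auto.
  - apply upper_total.
Qed.

Lemma interval_mono p (x y z : point) :
  point_le x z -> point_le z y -> interval p x -> interval p y -> interval p z.
Proof.
  intros Hxz Hzy [Hx _] [_ Hy]. split; [now apply (begun_mono x)|].
  intros Hz. apply Hy. now apply (ended_mono z).
Qed.

Lemma prec_ended p q (x : point) : p ≺ q -> begun x q -> ended x p.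
Proof.
  intros Hpq. destruct x as [s e|s e]; simpl.
  - intros Hq. eauto.
  - intros [_ Hq]. split; [now apply prec_D in Hpq|]. intros Hp. exact (Hq p Hp Hpq).
Qed.

Lemma interval_prec p q (x y : point) :
  p ≺ q -> interval p x -> interval q y -> ~ point_le y x.
Proof.
  intros Hpq [_ Hp] [Hq _] H. apply Hp, (prec_ended p q x Hpq).
  now apply (begun_mono y).
Qed.

Lemma incomparable_meet p q :
  D p -> D q -> ~ p ≺ q -> ~ q ≺ p -> exists x, interval p x /\ interval q x.
Proof.
  assert (H : forall p q n, p < n -> q < n -> D p -> D q -> ~ p ≺ q ->
            trace p q n -> exists x, interval p x /\ interval q x).
  { clear p q. intros p q n Hp Hq Dp Dq Hpq HT. exists (Left n q).
    split; split; simpl.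
    - now apply lower_seed.
    - intros (w & Hw & H). apply Hpq. now apply (lower_seed_max n q p w).
    - apply lower_seed; auto. apply trace_refl.
    - intros (w & Hw & H). apply (prec_irrefl q). now apply (lower_seed_max n q q w). }
  intros Dp Dq Hpq Hqp.
  destruct (lt_add_r p q) as [Bp _], (lt_add_r q p) as [_ Bq].
  destruct (trace_total p q (p + q + 𝟏) Dp Dq) as [HT|HT].
  - now apply (H p q (p + q + 𝟏)).
  - destruct (H q p (p + q + 𝟏)) as (x & Hx & Hx'); auto. now exists x.
Qed.

Lemma interval_separates p q t :
  D p -> D q -> ~ (trace p q t /\ trace q p t) ->
  exists x, interval p x /\ ~ interval q x.
Proof.
  intros Dp Dq H. set (n := p + q + t + 𝟏).
  assert (B : p < n /\ q < n /\ t < n).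
  { unfold n. repeat split; apply lt_iff_exists;
      [exists (q + t) | exists (p + t) | exists (p + q)]; ring. }
  destruct B as (Bp & Bq & Bt). apply not_and_or in H as [H|H].
  - exists (Right n p). split; [split|]; simpl.
    + split; [exact Dp|]. intros w Hw Hwp. apply (prec_irrefl p).
      now apply (upper_seed_min n p p w).
    + intros [_ Hn]. apply Hn, upper_seed; auto. apply trace_refl.
    + intros [_ Hq]. apply Hq. split; [exact Dq|]. intros Hu.
      apply upper_seed in Hu; auto. apply H. now apply trace_antitone with n.
  - exists (Left n p). split; [split|]; simpl.
    + apply lower_seed; auto. apply trace_refl.
    + intros (w & Hw & Hpw). apply (prec_irrefl p). now apply (lower_seed_max n p p w).
    + intros [Hq _]. apply lower_seed in Hq; auto.
      apply H. now apply trace_antitone with n.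
Qed.

Lemma interval_indistinguishable p q (x : point) :
  D q -> (forall t, trace p q t /\ trace q p t) -> interval p x -> interval q x.
Proof.
  intros Dq H [Hb He]. destruct x as [s e|s e]; simpl in *; split; simpl.
  - apply NNPP. intros Hn. destruct (lower_strict _ _ _ _ 𝟎 Hb Dq Hn) as [_ [t HT]].
    apply HT, H.
  - intros (w & Hw & Hqw). apply He. exists w. split; auto.
    apply (proj1 (H (w + 𝟏)) w); auto using lt_succ_diag.
  - split; auto. intros w Hw Hwq. apply (proj2 Hb w Hw).
    apply (proj2 (H (w + 𝟏)) w); auto using lt_succ_diag.
  - intros [_ Hn]. apply He. split; [apply Hb|]. intros Hu.
    destruct (upper_strict _ _ _ _ 𝟎 Hu Dq Hn) as [_ [t HT]]. apply HT, H.
Qed.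

(** ** Codes of points *)

Definition code (x : point) : N :=
  match x with
  | Left s e => pr 𝟎 (pr s e)
  | Right s e => pr 𝟏 (pr s e)
  end.

Lemma code_inj (x y : point) : code x = code y -> x = y.
Proof.
  assert (H01 : 𝟎 <> 𝟏).
  { intros E. apply (succ_neq_0 𝟎). now rewrite add_0_l. }
  destruct x, y; simpl; intros E; apply pr_inj in E as [E E'].
  2: contradiction.
  2: now symmetry in E.
  all: apply pr_inj in E' as [-> ->]; reflexivity.
Qed.

Lemma lt_code s e c : s < pr c (pr s e) + 𝟏 /\ e < pr c (pr s e) + 𝟏.
Proof.
  assert (B : forall u, u < pr s e + 𝟏 -> u < pr c (pr s e) + 𝟏).
  { intros u Hu. apply lt_succ in Hu as [Hu| ->].
    - apply lt_trans with (pr s e); [exact Hu | apply lt_pr_r].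
    - apply lt_pr_r. }
  split; apply B; [apply lt_pr_l | apply lt_pr_r].
Qed.

Definition code_le a b : Prop :=
  exists x y, a = code x /\ b = code y /\ point_le x y.

Definition code_interval p a : Prop := exists x, a = code x /\ interval p x.

Lemma code_le_iff a b : code_le a b <->
  exists s, s < a + 𝟏 /\ exists e, e < a + 𝟏 /\
  exists s', s' < b + 𝟏 /\ exists e', e' < b + 𝟏 /\
    ((a = pr 𝟎 (pr s e) /\ (b = pr 𝟎 (pr s' e') /\
        forall v, v < s + s' -> lower s e v -> lower s' e' v)) \/
     (a = pr 𝟏 (pr s e) /\ (b = pr 𝟏 (pr s' e') /\
        forall v, v < s' + s -> upper s' e' v -> upper s e v)) \/
     (a = pr 𝟎 (pr s e) /\ (b = pr 𝟏 (pr s' e') /\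
        ~ exists v, v < s + s' /\ exists w, w < s + s' /\
            (lower s e v /\ (upper s' e' w /\ w ≺ v)))) \/
     (a = pr 𝟏 (pr s e) /\ (b = pr 𝟎 (pr s' e') /\
        exists v, v < s' + s /\ exists w, w < s' + s /\
            (lower s' e' v /\ (upper s e w /\ w ≺ v))))).
Proof.
  split.
  - intros (x & y & -> & -> & H).
    destruct x as [s e|s e], y as [s' e'|s' e']; exists s;
      (split; [apply lt_code|]); exists e; (split; [apply lt_code|]); exists s';
      (split; [apply lt_code|]); exists e'; (split; [apply lt_code|]);
      simpl in *.
    + left. auto.
    + right. right. left. do 2 (split; auto). intros (v & _ & w & _ & Hv & Hw & Hwv).
      exact (H v w Hv Hw Hwv).
    + right. right. right. do 2 (split; auto). destruct H as (v & w & Hv & Hw & Hwv).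
      exact (crossing_bounded _ _ _ _ _ _ Hv Hw Hwv).
    + right. left. auto.
  - intros (s & _ & e & _ & s' & _ & e' & _ & [H|[H|[H|H]]]);
      destruct H as (-> & -> & H).
    + exists (Left s e), (Left s' e'). do 2 (split; [reflexivity|]).
      exact (lower_incl_bounded _ _ _ _ H).
    + exists (Right s e), (Right s' e'). do 2 (split; [reflexivity|]).
      exact (upper_incl_bounded _ _ _ _ H).
    + exists (Left s e), (Right s' e'). do 2 (split; [reflexivity|]).
      intros v w Hv Hw Hwv. apply H.
      exact (crossing_bounded _ _ _ _ _ _ Hv Hw Hwv).
    + exists (Right s e), (Left s' e'). do 2 (split; [reflexivity|]).
      destruct H as (v & _ & w & _ & Hv & Hw & Hwv). now exists v, w.
Qed.

Lemma code_interval_iff p a : code_interval p a <->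
  exists s, s < a + 𝟏 /\ exists e, e < a + 𝟏 /\
    ((a = pr 𝟎 (pr s e) /\ (lower s e p /\
        forall v, v < s + p + 𝟏 -> lower s e v -> ~ p ≺ v)) \/
     (a = pr 𝟏 (pr s e) /\ (upper s e p /\
        forall v, v < s + p + 𝟏 -> upper s e v -> ~ v ≺ p))).
Proof.
  assert (B : forall s u, u < s \/ u < p -> u < s + p + 𝟏).
  { intros s u [Hu|Hu]; apply lt_iff_exists in Hu as [z ->]; apply lt_iff_exists.
    - exists (z + p + 𝟏). ring.
    - exists (s + z + 𝟏). ring. }
  split.
  - intros (x & -> & Hb & He).
    destruct x as [s e|s e]; exists s; (split; [apply lt_code|]); exists e;
      (split; [apply lt_code|]); simpl in *.
    + left. do 2 (split; auto). intros v _ Hv Hpv. eauto.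
    + right. split; auto. split.
      * apply NNPP. intros Hn. apply He. tauto.
      * intros v _. apply Hb.
  - intros (s & _ & e & _ & [(-> & Hp & H)|(-> & Hp & H)]).
    + exists (Left s e). split; [reflexivity|]. split; [exact Hp|].
      intros (w & Hw & Hpw).
      destruct (lower_above_bounded _ _ _ _ Hw Hpw) as (u & Hu & Hpu & L).
      apply (H u); auto.
    + exists (Right s e). split; [reflexivity|]. split; simpl.
      * split; [now apply upper_D in Hp|]. intros w Hw Hwp.
        destruct (upper_below_bounded _ _ _ _ Hw Hwp) as (u & Hu & Hpu & L).
        apply (H u); auto.
      * tauto.
Qed.

Lemma Delta_code_le f g : Term M f -> Term M g ->
  Delta M (fun s : nat -> N => code_le (f s) (g s)).
Proof.
  intros Hf Hg. eapply Delta_ext; [intros s; symmetry; apply code_le_iff|]. delta.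
Qed.

Lemma Delta_code_interval f g : Term M f -> Term M g ->
  Delta M (fun s : nat -> N => code_interval (f s) (g s)).
Proof.
  intros Hf Hg. eapply Delta_ext; [intros s; symmetry; apply code_interval_iff|].
  delta.
Qed.
#[local] Hint Resolve Delta_code_le Delta_code_interval : definable.

Lemma code_le_points (x y : point) : code_le (code x) (code y) <-> point_le x y.
Proof.
  split; [|intros H; now exists x, y].
  intros (x' & y' & Hx & Hy & H). apply code_inj in Hx as ->.
  apply code_inj in Hy as ->. exact H.
Qed.

Lemma code_interval_point p (x : point) : code_interval p (code x) <-> interval p x.
Proof.
  split; [|intros H; now exists x].
  intros (x' & Hx & H). apply code_inj in Hx as ->. exact H.
Qed.

(* Several codes may determine the same point; the linear order consists of
   the least ones. *)
Definition canonical a : Prop :=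
  code_le a a /\ forall b, b < a -> ~ (code_le a b /\ code_le b a).

Lemma Delta_canonical f : Term M f ->
  Delta M (fun s : nat -> N => canonical (f s)).
Proof. intros. unfold canonical. delta. Qed.
#[local] Hint Resolve Delta_canonical : definable.

Lemma canonical_code a : canonical a -> exists x, a = code x.
Proof. intros [(x & _ & Hx & _) _]. eauto. Qed.

Lemma canonical_point (x : point) :
  exists y, canonical (code y) /\ point_le x y /\ point_le y x.
Proof.
  destruct (least_element (fun a => code_le (code x) a /\ code_le a (code x)) (code x))
    as (m & [Hxm Hmx] & Hmin); [delta| |].
  - assert (point_le x x) by (destruct (point_le_total x x); auto).
    split; now apply code_le_points.
  - destruct Hmx as (y & x' & -> & Hx & Hyx). apply code_inj in Hx as <-.
    apply code_le_points in Hxm. exists y. repeat split; auto.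
    + apply code_le_points. destruct (point_le_total y y); auto.
    + intros b Hb [Hyb Hby]. apply (Hmin b Hb).
      destruct Hyb as (y' & z & Hy & -> & Hyz). apply code_inj in Hy as <-.
      apply (code_le_points z y) in Hby.
      split; apply code_le_points; eauto using point_le_trans.
Qed.

Lemma canonical_interval p (x : point) : interval p x ->
  exists y, canonical (code y) /\ interval p y /\ forall q, interval q y <-> interval q x.
Proof.
  intros Hp. destruct (canonical_point x) as (y & Hy & Hxy & Hyx).
  exists y. split; [exact Hy|].
  assert (E : forall q, interval q y <-> interval q x).
  { intros q. split; intros H.
    - now apply (interval_mono q y y x).
    - now apply (interval_mono q x x y). }
  split; [now apply E | exact E].
Qed.

Theorem semiorder_representation : exists L S F : set M,
  (forall z, mem M z S -> exists a, mem M a L /\ exists b, mem M b L /\ z = pr a b) /\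
  (forall a, mem M a L -> mem M (pr a a) S) /\
  (forall a b c, mem M a L -> mem M b L -> mem M c L ->
     mem M (pr a b) S -> mem M (pr b c) S -> mem M (pr a c) S) /\
  (forall a b, mem M a L -> mem M b L ->
     mem M (pr a b) S -> mem M (pr b a) S -> a = b) /\
  (forall a b, mem M a L -> mem M b L -> mem M (pr a b) S \/ mem M (pr b a) S) /\
  (forall z, mem M z F -> exists p, D p /\ exists a, mem M a L /\ z = pr p a) /\
  (forall p, D p -> exists a, mem M (pr p a) F) /\
  (forall p a b c, D p -> mem M a L -> mem M b L -> mem M c L ->
     mem M (pr p a) F -> mem M (pr p b) F ->
     mem M (pr a c) S -> mem M (pr c b) S -> mem M (pr p c) F) /\
  (forall p q, D p -> D q -> (p ≺ q <-> forall a b,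
     mem M (pr p a) F -> mem M (pr q b) F -> mem M (pr a b) S /\ a <> b)) /\
  (forall p q, D p -> D q -> (forall a, mem M (pr p a) F -> mem M (pr q a) F) ->
     forall a, mem M (pr p a) F <-> mem M (pr q a) F).
Proof.
  destruct (comprehension M HM canonical) as [L HL]; [delta|].
  destruct (comprehension M HM (fun z => exists a, a < z + 𝟏 /\ exists b, b < z + 𝟏 /\
    (z = pr a b /\ (canonical a /\ (canonical b /\ code_le a b))))) as [S HS]; [delta|].
  destruct (comprehension M HM (fun z => exists p, p < z + 𝟏 /\ exists a, a < z + 𝟏 /\
    (z = pr p a /\ (D p /\ (canonical a /\ code_interval p a))))) as [F HF]; [delta|].
  exists L, S, F.
  assert (ES : forall x y : point, mem M (pr (code x) (code y)) S <->
    canonical (code x) /\ canonical (code y) /\ point_le x y).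
  { intros x y. rewrite HS, <- code_le_points. split.
    - intros (a & _ & b & _ & E & H). apply pr_inj in E as [-> ->]. exact H.
    - intros H. exists (code x). split; [apply lt_pr_l|]. exists (code y).
      split; [apply lt_pr_r | auto]. }
  assert (EF : forall p (x : point), mem M (pr p (code x)) F <->
    D p /\ canonical (code x) /\ interval p x).
  { intros p x. rewrite HF, <- code_interval_point. split.
    - intros (q & _ & a & _ & E & H). apply pr_inj in E as [-> ->]. exact H.
    - intros H. exists p. split; [apply lt_pr_l|]. exists (code x).
      split; [apply lt_pr_r | auto]. }
  assert (CL : forall a, mem M a L -> exists x : point, a = code x /\ canonical (code x)).
  { intros a Ha. apply HL in Ha. destruct (canonical_code a Ha) as [x ->]. eauto. }
  assert (CF : forall p a, mem M (pr p a) F -> exists x : point,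
    a = code x /\ canonical (code x) /\ interval p x).
  { intros p a H. assert (H' := H). apply HF in H as (q & _ & b & _ & E & _ & H & _).
    apply pr_inj in E as [_ <-]. destruct (canonical_code a H) as [x ->].
    exists x. apply EF in H'. tauto. }
  assert (NE : forall p, D p -> exists x, canonical (code x) /\ interval p x).
  { intros p Hp. destruct (incomparable_meet p p) as (x & Hx & _); auto.
    destruct (canonical_interval p x Hx) as (y & Hy & H & _). eauto. }
  repeat match goal with |- _ /\ _ => split end.
  - intros z Hz. apply HS in Hz as (a & _ & b & _ & E & Ha & Hb & _).
    exists a. split; [now apply HL|]. exists b. split; [now apply HL | exact E].
  - intros a Ha. destruct (CL a Ha) as (x & -> & Hx). apply ES.
    do 2 (split; [exact Hx|]). destruct (point_le_total x x); auto.
  - intros a b c Ha Hb Hc Hab Hbc.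
    destruct (CL a Ha) as (x & -> & _), (CL b Hb) as (y & -> & _),
      (CL c Hc) as (z & -> & _).
    apply ES in Hab as (Hx & _ & Hxy). apply ES in Hbc as (_ & Hz & Hyz).
    apply ES. eauto using point_le_trans.
  - intros a b Ha Hb Hab Hba.
    destruct (CL a Ha) as (x & -> & _), (CL b Hb) as (y & -> & _).
    apply ES in Hab as (Hx & Hy & Hxy). apply ES in Hba as (_ & _ & Hyx).
    apply code_le_points in Hxy, Hyx.
    destruct (lt_trichotomy (code x) (code y)) as [H|[H|H]]; [|exact H|].
    + now destruct (proj2 Hy _ H).
    + now destruct (proj2 Hx _ H).
  - intros a b Ha Hb.
    destruct (CL a Ha) as (x & -> & Hx), (CL b Hb) as (y & -> & Hy).
    rewrite !ES. destruct (point_le_total x y); auto.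
  - intros z Hz. apply HF in Hz as (p & _ & a & _ & E & Hp & Ha & _).
    exists p. split; [exact Hp|]. exists a. split; [now apply HL | exact E].
  - intros p Hp. destruct (NE p Hp) as (x & Hx & H). exists (code x). now apply EF.
  - intros p a b c Hp Ha Hb Hc Hpa Hpb Hac Hcb.
    destruct (CL a Ha) as (x & -> & _), (CL b Hb) as (y & -> & _),
      (CL c Hc) as (z & -> & Hz).
    apply EF in Hpa as (_ & _ & Hpx). apply EF in Hpb as (_ & _ & Hpy).
    apply ES in Hac as (_ & _ & Hxz). apply ES in Hcb as (_ & _ & Hzy).
    apply EF. do 2 (split; auto). now apply (interval_mono p x y z).
  - intros p q Dp Dq.
    assert (FW : p ≺ q -> forall x y : point, interval p x -> interval q y ->
      point_le x y /\ x <> y).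
    { intros Hpq x y Hx Hy. pose proof (interval_prec p q x y Hpq Hx Hy) as HN.
      destruct (point_le_total x y) as [H|H]; [|contradiction].
      split; [exact H|]. now intros <-. }
    assert (FW' : p ≺ q -> forall a b,
      mem M (pr p a) F -> mem M (pr q b) F -> mem M (pr a b) S /\ a <> b).
    { intros Hpq a b Ha Hb. apply CF in Ha as (x & -> & Cx & Hx).
      apply CF in Hb as (y & -> & Cy & Hy).
      destruct (FW Hpq x y Hx Hy) as [Hle Hne]. split.
      - now apply ES.
      - intros E. now apply code_inj in E. }
    split; [exact FW'|]. intros H. apply NNPP. intros Hpq.
    destruct (classic (q ≺ p)) as [Hqp|Hqp].
    + destruct (NE p Dp) as (x & Cx & Hx), (NE q Dq) as (y & Cy & Hy).
      apply (interval_prec q p y x Hqp Hy Hx).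
      destruct (H (code x) (code y)) as [Hle _]; try now apply EF.
      apply ES in Hle. tauto.
    + destruct (incomparable_meet p q Dp Dq Hpq Hqp) as (x & Hpx & Hqx).
      destruct (canonical_interval p x Hpx) as (y & Cy & Hpy & E).
      assert (Hqy : interval q y) by now apply E.
      destruct (H (code y) (code y)) as [_ Hne]; try now apply EF.
      now apply Hne.
  - intros p q Dp Dq H a. split; [apply H|]. intros Hqa.
    apply CF in Hqa as (x & -> & Cx & Hx). apply EF. do 2 (split; auto).
    apply (interval_indistinguishable q p x Dp); [|exact Hx].
    intros t. apply NNPP. intros HN.
    destruct (interval_separates p q t) as (y & Hpy & Hqy); auto.
    { tauto. }
    destruct (canonical_interval p y Hpy) as (z & Cz & Hpz & E).
    apply Hqy, E. apply EF. apply H. now apply EF.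
Qed.

End Order.
End Arithmetic.

Lemma sat_srel M s r R t u : sat M s r (srel R t u)
  <-> mem M (pr M (eval M s t) (eval M s u)) (r R) /\ eval M s t <> eval M s u.
Proof. unfold srel. now rewrite sat_and. Qed.

Lemma sat_fex_in M s r D phi : sat M s r (fex_in D phi)
  <-> exists x, mem M x (r D) /\ sat M (scons x s) r phi.
Proof.
  unfold fex_in. rewrite sat_ex.
  split; intros [x Hx]; exists x; now apply sat_and in Hx || apply sat_and.
Qed.

Lemma sat_subset_prod M s r R D E : sat M s r (subset_prod R D E)
  <-> forall z, mem M z (r R) -> exists x, mem M x (r D) /\
        exists y, mem M y (r E) /\ z = pr M x y.
Proof.
  unfold subset_prod. cbn [sat eval scons].
  split; intros H z Hz; specialize (H z Hz).
  - apply sat_fex_in in H as (x & Hx & H). apply sat_fex_in in H as (y & Hy & H).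
    eauto.
  - destruct H as (x & Hx & y & Hy & H).
    apply sat_fex_in. exists x. split; [exact Hx|]. apply sat_fex_in. eauto.
Qed.

Theorem theorem6p18 :
  RCA0 ⊢
    (fAll (fAll
      (let P := 1%nat in let leP := 0%nat in
       partial_order P leP ⇒
       omits_2plus2 P leP ⇒
       omits_3plus1 P leP ⇒
       proper_interval_order P leP)))%form.
Proof.
  apply completeness; [apply RCA0_subst_stable|].
  intros M HM s r0 P R. set (r := scons R (scons P r0)).
  intros HPO H22 H31.
  unfold partial_order in HPO. rewrite !sat_and, sat_subset_prod in HPO.
  destruct HPO as (Hsub & Hrefl & Htrans & Hanti).
  set (prec := fun p q => mem M (pr M p q) R /\ p <> q).
  assert (prec_dom : forall p q, prec p q -> mem M p P /\ mem M q P).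
  { intros p q [H _]. destruct (Hsub _ H) as (x & Hx & y & Hy & E).
    apply (pr_inj M P HM) in E as [-> ->]. now split. }
  assert (prec_trans : forall p q o, prec p q -> prec q o -> prec p o).
  { intros p q o Hpq Hqo.
    destruct (prec_dom _ _ Hpq) as [Dp Dq], (prec_dom _ _ Hqo) as [_ Do].
    destruct Hpq as [Hpq Npq], Hqo as [Hqo Nqo]. split.
    - exact (Htrans p Dp q Dq o Do Hpq Hqo).
    - intros <-. apply Npq. exact (Hanti p Dp q Dq Hpq Hqo). }
  assert (prec_of_le : forall p q, mem M (pr M p q) R -> prec p q \/ p = q).
  { intros p q H. destruct (classic (p = q)); [now right | left; now split]. }
  destruct (semiorder_representation M P HM (fun x => mem M x P) prec)
    as (L & S & F & HS & Srefl & Strans & Santi & Stotal & HF & Fne & Fconv &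
        Frep & Fprop).
  - intros f Hf. delta.
  - intros f g Hf Hg. unfold prec. delta.
  - exact prec_dom.
  - intros p [_ H]. now apply H.
  - intros p0 q0 p1 q1 H0 H1.
    destruct (prec_dom _ _ H0) as [Dp0 Dq0], (prec_dom _ _ H1) as [Dp1 Dq1].
    destruct (classic (mem M (pr M p0 q1) R)) as [H|H];
      [|apply (H22 p0 Dp0 q0 Dq0 p1 Dp1 q1 Dq1
          ltac:(now apply sat_srel) ltac:(now apply sat_srel)) in H];
      apply prec_of_le in H as [H|E]; eauto;
      cbn in E; subst; eauto.
  - intros p0 p1 p2 q H0 H1 Dq.
    destruct (prec_dom _ _ H0) as [Dp0 Dp1], (prec_dom _ _ H1) as [_ Dp2].
    destruct (classic (mem M (pr M p0 q) R)) as [H|H];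
      [|apply (H31 p0 Dp0 p1 Dp1 p2 Dp2 q Dq
          ltac:(now apply sat_srel) ltac:(now apply sat_srel)) in H];
      apply prec_of_le in H as [H|E]; eauto;
      cbn in E; subst; eauto.
  - apply sat_Ex. exists L. apply sat_Ex. exists S. apply sat_Ex. exists F.
    unfold proper_representation, linear_order, partial_order.
    rewrite !sat_and, !sat_subset_prod.
    repeat match goal with |- _ /\ _ => split end.
    + exact HS.
    + exact Srefl.
    + intros a Ha b Hb c Hc. exact (Strans a b c Ha Hb Hc).
    + intros a Ha b Hb. exact (Santi a b Ha Hb).
    + intros a Ha b Hb. apply sat_or. exact (Stotal a b Ha Hb).
    + exact HF.
    + intros p Hp. apply sat_ex. exact (Fne p Hp).
    + intros p Dp a Ha b Hb c Hc Hpa Hpb Hac Hcb.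
      apply sat_srel in Hac as [Hac _]. apply sat_srel in Hcb as [Hcb _].
      exact (Fconv p a b c Dp Ha Hb Hc Hpa Hpb Hac Hcb).
    + intros p Dp q Dq. apply sat_iff. rewrite sat_srel.
      etransitivity; [exact (Frep p q Dp Dq)|].
      split; intros H a b Ha Hb.
      * apply sat_srel. now apply H.
      * exact (proj1 (sat_srel _ _ _ _ _ _) (H a b Ha Hb)).
    + intros p Dp q Dq H a. apply sat_iff. exact (Fprop p q Dp Dq H a).
Qed.
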